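(* Let $(E,C)$ be a separated graph without isolated vertices, and let $K$ be a commutative ring with unit (endowed with an involution). Then $$\mathcal C_K^{\mathrm{ab}}(E,C)\cong K[\mathcal S(E,C)].$$ Moreover, there is an isomorphism of $C^*$-algebras $$\mathcal T(E,C)\cong C^*(\mathcal S(E,C)).$$
   Context: A directed graph $E=(E^0,E^1,s,r)$ consists of sets $E^0$, $E^1$ (arbitrary cardinality) and maps $s,r\colon E^1\to E^0$. A separated graph $(E,C)$ is a directed graph with $C=\bigsqcup_{v}C_v$, where $C_v$ is a partition of $s^{-1}(v)$ into pairwise disjoint nonempty subsets ($C_v=\emptyset$ if $s^{-1}(v)=\emptyset$). A vertex $v$ is isolated if $s^{-1}(v)=r^{-1}(v)=\emptyset$. $E^{-1}=\{e^{-1}:e\in E^1\}$, $\hat E^1=E^1\sqcup E^{-1}$, $s(e^{-1})=r(e)$, $r(e^{-1})=s(e)$. $\mathcal S(E,C)$ is the universal inverse semigroup with zero generated by $E^0\cup\hat E^1$ subject to: (1) $vw=\delta_{v,w}v$; (2) $s(x)x=x$ and (3) $xr(x)=x$ for $x\in\hat E^1$; (4) $e^{-1}f=\delta_{e,f}r(e)$ for $e,f\in X$, $X\in C$. A $*$-algebra over $K$ is a $K$-algebra with a conjugate-linear anti-multiplicative involution. The Cohn path algebra $\mathcal C_K(E,C)$ is the universal $*$-algebra over $K$ generated by self-adjoint $v\in E^0$ and $e\in E^1$ subject to: $vw=\delta_{v,w}v$ for $v,w\in E^0$; $s(e)e=e=er(e)$ and $e^*s(e)=e^*=r(e)e^*$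 for $e\in E^1$; $e^*f=\delta_{e,f}r(e)$ for $e,f\in X$, $X\in C$. The tame Cohn path algebra $\mathcal C_K^{\mathrm{ab}}(E,C)$ is its quotient by the $*$-ideal generated by the commutators $[xx^*,yy^*]$ with $x,y$ in the multiplicative $*$-subsemigroup generated by $E^0\cup E^1$. The Toeplitz path $C^*$-algebra $\mathcal{TP}(E,C)$ is the enveloping (universal) $C^*$-algebra of $\mathcal C_{\mathbb C}(E,C)$, and the Toeplitz algebra $\mathcal T(E,C)$ is its quotient by the closed ideal generated by the same commutators. For an inverse semigroup $S$ with zero (or a $*$-semigroup with zero), $K[S]$ is the $*$-algebra over $K$ universal for zero-preserving $*$-homomorphisms of $S$ into $*$-algebras (multiplicative maps $\pi$ with $\pi(s^{-1})=\pi(s)^*$), i.e. the semigroup algebra with the zero of $S$ identified with $0$; $C^*(S)$ is the enveloping $C^*$-algebra of $\mathbb C[S]$, universal for zero-preserving $*$-homomorphisms of $S$ into $C^*$-algebras. *)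

(* Defs.v *)
(* K-algebras are associative and not necessarily unital;
   their product is the one of semigroupType, written (x * y)%g. *)
From HB Require Import structures.
From mathcomp Require Import all_boot all_order all_algebra complex.
From mathcomp Require Import all_classical all_reals all_analysis.

Set Implicit Arguments.
Unset Strict Implicit.
Unset Printing Implicit Defensive.

Import GRing.Theory Num.Theory.
Import numFieldNormedType.Exports.

Local Open Scope classical_set_scope.
Local Open Scope quotient_scope.
Local Open Scope ring_scope.

Record sepgraph := SepGraph {
  vtx : Type;
  edg : Type;
  src : edg -> vtx;
  rng : edg -> vtx;
  cls : vtx -> set (set edg);
  cls_partition : forall v, partition (cls v) id [set e | src e = v] }.

Arguments src {_} _.
Arguments rng {_} _.
Arguments cls {_} _.

Definition isolated_vertex (E : sepgraph) (v : vtx E) : Prop :=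
  [set e : edg E | src e = v] = set0 /\ [set e : edg E | rng e = v] = set0.

(* [inl e] is the edge e, [inr e] is the formal inverse e^{-1}. *)
Definition hedg (E : sepgraph) : Type := (edg E + edg E)%type.

Definition hsrc (E : sepgraph) (x : hedg E) : vtx E :=
  match x with inl e => src e | inr e => rng e end.

Definition hrng (E : sepgraph) (x : hedg E) : vtx E :=
  match x with inl e => rng e | inr e => src e end.

HB.mixin Record isInvSemigroup0 S of Semigroup S := {
  zeros : S;
  invs : S -> S;
  mul0s : forall x : S, (zeros * x)%g = zeros;
  muls0 : forall x : S, (x * zeros)%g = zeros;
  mulsVs : forall x : S, (x * invs x * x)%g = x;
  mulVsV : forall x : S, (invs x * x * invs x)%g = invs x;
  invs_uniq : forall x y : S,
    (x * y * x)%g = x -> (y * x * y)%g = y -> y = invs x }.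

#[short(type="invSemigroup0Type")]
HB.structure Definition InvSemigroup0 := {S of isInvSemigroup0 S & Semigroup S}.

Inductive isterm (X : Type) : Type :=
| IVar of X
| IZero
| IMul of isterm X & isterm X
| IInv of isterm X.

Arguments IVar {X} _.
Arguments IZero {X}.

HB.instance Definition _ X := gen_eqMixin (isterm X).
HB.instance Definition _ X := gen_choiceMixin (isterm X).

Fixpoint iseval (X : Type) (S : invSemigroup0Type) (f : X -> S)
    (t : isterm X) : S :=
  match t with
  | IVar x => f x
  | IZero => zeros
  | IMul t u => (iseval f t * iseval f u)%g
  | IInv t => invs (iseval f t)
  end.

(* The universal inverse semigroup with zero generated by X subject to the
   relations t = u for rel t u: two terms are identified when every
   interpretation of X that satisfies the relations gives them the same value.
   [isgp_lift] is its universal property. *)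
Section PresentedInverseSemigroup.
Variables (X : Type) (rel : isterm X -> isterm X -> Prop).

Definition is_satisfies (S : invSemigroup0Type) (f : X -> S) : Prop :=
  forall t u, rel t u -> iseval f t = iseval f u.

Definition is_eqv (t u : isterm X) : Prop :=
  forall (S : invSemigroup0Type) (f : X -> S),
    is_satisfies f -> iseval f t = iseval f u.

Definition is_eqvb (t u : isterm X) : bool := `[< is_eqv t u >].

Lemma is_eqvb_equiv : equiv_class_of is_eqvb.
Proof.
split=> [t|t u|u t v].
- exact/asboolP.
- by apply/asboolP/asboolP => h S f hf; rewrite (h S f hf).
- move=> /asboolP h /asboolP k; apply/asboolP => S f hf.
  by rewrite (h S f hf) (k S f hf).
Qed.

Canonical is_eqvb_rel := EquivRelPack is_eqvb_equiv.

Definition isgp : Type := {eq_quot is_eqvb}%qT.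
HB.instance Definition _ := Choice.copy isgp {eq_quot is_eqvb}%qT.

Definition isgp_pi (t : isterm X) : isgp := \pi_({eq_quot is_eqvb}%qT) t.
Definition isgp_repr (x : isgp) : isterm X := repr (x : {eq_quot is_eqvb}%qT).

Lemma isgp_reprK x : isgp_pi (isgp_repr x) = x.
Proof. exact: reprK. Qed.

Lemma isgp_piP t u : isgp_pi t = isgp_pi u <-> is_eqv t u.
Proof.
split=> [h|h]; first by apply/asboolP; exact/(@eqmodP _ is_eqvb_rel).
by apply/(@eqmodP _ is_eqvb_rel)/asboolP.
Qed.

Definition isgp_eval (S : invSemigroup0Type) (f : X -> S) (x : isgp) : S :=
  iseval f (isgp_repr x).

Lemma isgp_eval_pi (S : invSemigroup0Type) (f : X -> S) t :
  is_satisfies f -> isgp_eval f (isgp_pi t) = iseval f t.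
Proof. by move=> hf; have /isgp_piP := isgp_reprK (isgp_pi t); apply. Qed.

Lemma isgp_ext x y :
  (forall (S : invSemigroup0Type) (f : X -> S), is_satisfies f ->
     isgp_eval f x = isgp_eval f y) -> x = y.
Proof. by move=> h; rewrite -[x]isgp_reprK -[y]isgp_reprK; apply/isgp_piP. Qed.

Definition isgp_gen (x : X) : isgp := isgp_pi (IVar x).
Definition isgp_zero : isgp := isgp_pi IZero.
Definition isgp_mul (x y : isgp) := isgp_pi (IMul (isgp_repr x) (isgp_repr y)).
Definition isgp_inv (x : isgp) := isgp_pi (IInv (isgp_repr x)).

Lemma isgp_evalE (S : invSemigroup0Type) (f : X -> S) : is_satisfies f ->
  (isgp_eval f isgp_zero = zeros) *
  (forall x y, isgp_eval f (isgp_mul x y) =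
     (isgp_eval f x * isgp_eval f y)%g) *
  (forall x, isgp_eval f (isgp_inv x) = invs (isgp_eval f x)).
Proof. by move=> hf; do !split=> *; rewrite isgp_eval_pi. Qed.

Lemma isgp_mulA : associative isgp_mul.
Proof. by move=> x y z; apply: isgp_ext => S f hf; rewrite !(isgp_evalE hf) mulgA. Qed.

HB.instance Definition _ := isSemigroup.Build isgp isgp_mulA.

Lemma isgp_mul0s (x : isgp) : (isgp_zero * x)%g = isgp_zero.
Proof. by apply: isgp_ext => S f hf; rewrite !(isgp_evalE hf) mul0s. Qed.

Lemma isgp_muls0 (x : isgp) : (x * isgp_zero)%g = isgp_zero.
Proof. by apply: isgp_ext => S f hf; rewrite !(isgp_evalE hf) muls0. Qed.

Lemma isgp_mulsVs (x : isgp) : (x * isgp_inv x * x)%g = x.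
Proof. by apply: isgp_ext => S f hf; rewrite !(isgp_evalE hf) mulsVs. Qed.

Lemma isgp_mulVsV (x : isgp) : (isgp_inv x * x * isgp_inv x)%g = isgp_inv x.
Proof. by apply: isgp_ext => S f hf; rewrite !(isgp_evalE hf) mulVsV. Qed.

Lemma isgp_inv_uniq (x y : isgp) :
  (x * y * x)%g = x -> (y * x * y)%g = y -> y = isgp_inv x.
Proof.
move=> h k; apply: isgp_ext => S f hf; rewrite (isgp_evalE hf).
by apply: invs_uniq; rewrite -!(isgp_evalE hf) ?[isgp_mul _ _]h ?[isgp_mul _ _]k.
Qed.

HB.instance Definition _ := isInvSemigroup0.Build isgp
  isgp_mul0s isgp_muls0 isgp_mulsVs isgp_mulVsV isgp_inv_uniq.

Lemma iseval_gen t : iseval isgp_gen t = isgp_pi t.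
Proof.
by elim: t => [x||t IHt u IHu|t IHt] //=;
  rewrite ?IHt ?IHu; apply: isgp_ext => S f hf;
  rewrite !(isgp_evalE hf) !(isgp_eval_pi _ hf).
Qed.

Lemma isgp_gen_satisfies : is_satisfies isgp_gen.
Proof.
by move=> t u tu; rewrite !iseval_gen; apply/isgp_piP => S f hf; exact: hf.
Qed.

Lemma isgp_lift (S : invSemigroup0Type) (f : X -> S) : is_satisfies f ->
  exists! g : isgp -> S,
    [/\ forall x, g (isgp_gen x) = f x, g zeros = zeros,
        {morph g : x y / (x * y)%g} & {morph g : x / invs x}].
Proof.
move=> hf; exists (isgp_eval f); split.
  by split=> [x||x y|x]; rewrite ?(isgp_evalE hf) ?(isgp_eval_pi _ hf).
move=> g [gX g0 gM gV]; apply/funext => x.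
rewrite -[in RHS](isgp_reprK x) -iseval_gen /isgp_eval.
by elim: (isgp_repr x) => [y||t IHt u IHu|t IHt] //=;
  rewrite ?gX ?g0 ?gM ?gV ?IHt ?IHu.
Qed.

End PresentedInverseSemigroup.

HB.mixin Record hasInvolution K of GRing.ComPzRing K := {
  invol : K -> K;
  involD : {morph invol : x y / x + y};
  involM : {morph invol : x y / x * y};
  involK : involutive invol }.

#[short(type="involComPzRingType")]
HB.structure Definition InvolComPzRing :=
  {K of hasInvolution K & GRing.ComPzRing K}.

HB.instance Definition _ (R : realType) :=
  hasInvolution.Build R[i] (@raddfD _ _ (@conjc R)) (@rmorphM _ _ (@conjc R))
    (@conjcK R).

HB.mixin Record isStarAlgebra (K : involComPzRingType) A
    of GRing.Lmodule K A & Semigroup A := {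
  star : A -> A;
  starmulDl : forall x y z : A, ((x + y)%R * z)%g = (x * z)%g + (y * z)%g;
  starmulDr : forall x y z : A, (x * (y + z)%R)%g = (x * y)%g + (x * z)%g;
  starmulZl : forall (k : K) (x y : A), ((k *: x)%R * y)%g = k *: (x * y)%g;
  starmulZr : forall (k : K) (x y : A), (x * (k *: y)%R)%g = k *: (x * y)%g;
  starD : {morph star : x y / x + y};
  starZ : forall (k : K) (x : A), star (k *: x) = invol k *: star x;
  starM : forall x y : A, star (x * y)%g = (star y * star x)%g;
  starK : involutive star }.

#[short(type="starAlgType")]
HB.structure Definition StarAlgebra (K : involComPzRingType) :=
  {A of isStarAlgebra K A & GRing.Lmodule K A & Semigroup A}.

Definition star_hom (K : involComPzRingType) (A B : starAlgType K)
    (f : A -> B) : Prop :=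
  [/\ linear f, {morph f : x y / (x * y)%g} & {morph f : x / star x}].

Definition star_iso (K : involComPzRingType) (A B : starAlgType K)
    (f : A -> B) : Prop := star_hom f /\ bijective f.

Inductive sterm (K : Type) (X : Type) : Type :=
| SVar of X
| SZero
| SAdd of sterm K X & sterm K X
| SScale of K & sterm K X
| SMul of sterm K X & sterm K X
| SStar of sterm K X.

Arguments SVar {K X} _.
Arguments SZero {K X}.

HB.instance Definition _ K X := gen_eqMixin (sterm K X).
HB.instance Definition _ K X := gen_choiceMixin (sterm K X).

Fixpoint seval (K : involComPzRingType) (X : Type) (A : starAlgType K)
    (f : X -> A) (t : sterm K X) : A :=
  match t with
  | SVar x => f x
  | SZero => 0
  | SAdd t u => seval f t + seval f u
  | SScale k t => k *: seval f t
  | SMul t u => (seval f t * seval f u)%g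
  | SStar t => star (seval f t)
  end.

(* The universal *-algebra over K generated by X subject to the relations
   t = u for rel t u, built as above; [salg_lift] is its universal property. *)
Section PresentedStarAlgebra.
Variables (K : involComPzRingType) (X : Type).
Variable rel : sterm K X -> sterm K X -> Prop.

Definition star_satisfies (A : starAlgType K) (f : X -> A) : Prop :=
  forall t u, rel t u -> seval f t = seval f u.

Definition star_eqv (t u : sterm K X) : Prop :=
  forall (A : starAlgType K) (f : X -> A),
    star_satisfies f -> seval f t = seval f u.

Definition star_eqvb (t u : sterm K X) : bool := `[< star_eqv t u >].

Lemma star_eqvb_equiv : equiv_class_of star_eqvb.
Proof.
split=> [t|t u|u t v].
- exact/asboolP.
- by apply/asboolP/asboolP => h A f hf; rewrite (h A f hf).
- move=> /asboolP h /asboolP k; apply/asboolP => A f hf.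
  by rewrite (h A f hf) (k A f hf).
Qed.

Canonical star_eqvb_rel := EquivRelPack star_eqvb_equiv.

Definition salg : Type := {eq_quot star_eqvb}%qT.
HB.instance Definition _ := Choice.copy salg {eq_quot star_eqvb}%qT.

Definition salg_pi (t : sterm K X) : salg := \pi_({eq_quot star_eqvb}%qT) t.
Definition salg_repr (x : salg) : sterm K X :=
  repr (x : {eq_quot star_eqvb}%qT).

Lemma salg_reprK x : salg_pi (salg_repr x) = x.
Proof. exact: reprK. Qed.

Lemma salg_piP t u : salg_pi t = salg_pi u <-> star_eqv t u.
Proof.
split=> [h|h]; first by apply/asboolP; exact/(@eqmodP _ star_eqvb_rel).
by apply/(@eqmodP _ star_eqvb_rel)/asboolP.
Qed.

Definition salg_eval (A : starAlgType K) (f : X -> A) (x : salg) : A :=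
  seval f (salg_repr x).

Lemma salg_eval_pi (A : starAlgType K) (f : X -> A) t :
  star_satisfies f -> salg_eval f (salg_pi t) = seval f t.
Proof. by move=> hf; have /salg_piP := salg_reprK (salg_pi t); apply. Qed.

Lemma salg_ext x y :
  (forall (A : starAlgType K) (f : X -> A), star_satisfies f ->
     salg_eval f x = salg_eval f y) -> x = y.
Proof. by move=> h; rewrite -[x]salg_reprK -[y]salg_reprK; apply/salg_piP. Qed.

Definition salg_gen (x : X) : salg := salg_pi (SVar x).
Definition salg_zero : salg := salg_pi SZero.
Definition salg_add (x y : salg) := salg_pi (SAdd (salg_repr x) (salg_repr y)).
Definition salg_scale (k : K) (x : salg) := salg_pi (SScale k (salg_repr x)).
Definition salg_opp (x : salg) := salg_scale (-1) x.
Definition salg_mul (x y : salg) := salg_pi (SMul (salg_repr x) (salg_repr y)).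
Definition salg_star (x : salg) := salg_pi (SStar (salg_repr x)).

Lemma salg_evalE (A : starAlgType K) (f : X -> A) : star_satisfies f ->
  (salg_eval f salg_zero = 0) *
  (forall x y, salg_eval f (salg_add x y) = salg_eval f x + salg_eval f y) *
  (forall k x, salg_eval f (salg_scale k x) = k *: salg_eval f x) *
  (forall x, salg_eval f (salg_opp x) = - salg_eval f x) *
  (forall x y, salg_eval f (salg_mul x y) =
     (salg_eval f x * salg_eval f y)%g) *
  (forall x, salg_eval f (salg_star x) = star (salg_eval f x)).
Proof.
by move=> hf; do !split=> *; rewrite salg_eval_pi //= scaleN1r.
Qed.

Lemma salg_addA : associative salg_add.
Proof. by move=> x y z; apply: salg_ext => A f hf; rewrite !(salg_evalE hf) addrA. Qed.

Lemma salg_addC : commutative salg_add.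
Proof. by move=> x y; apply: salg_ext => A f hf; rewrite !(salg_evalE hf) addrC. Qed.

Lemma salg_add0 : left_id salg_zero salg_add.
Proof. by move=> x; apply: salg_ext => A f hf; rewrite !(salg_evalE hf) add0r. Qed.

Lemma salg_addN : left_inverse salg_zero salg_opp salg_add.
Proof. by move=> x; apply: salg_ext => A f hf; rewrite !(salg_evalE hf) addNr. Qed.

HB.instance Definition _ :=
  GRing.isZmodule.Build salg salg_addA salg_addC salg_add0 salg_addN.

Lemma salg_scaleA k l x :
  salg_scale k (salg_scale l x) = salg_scale (k * l) x.
Proof. by apply: salg_ext => A f hf; rewrite !(salg_evalE hf) scalerA. Qed.

Lemma salg_scale1 : left_id 1 salg_scale.
Proof. by move=> x; apply: salg_ext => A f hf; rewrite !(salg_evalE hf) scale1r. Qed.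

Lemma salg_scaleDr : right_distributive salg_scale +%R.
Proof. by move=> k x y; apply: salg_ext => A f hf; rewrite !(salg_evalE hf) scalerDr. Qed.

Lemma salg_scaleDl x : {morph salg_scale^~ x : k l / k + l}.
Proof. by move=> k l; apply: salg_ext => A f hf; rewrite !(salg_evalE hf) scalerDl. Qed.

HB.instance Definition _ := GRing.Zmodule_isLmodule.Build K salg
  salg_scaleA salg_scale1 salg_scaleDr salg_scaleDl.

Lemma salg_mulA : associative salg_mul.
Proof. by move=> x y z; apply: salg_ext => A f hf; rewrite !(salg_evalE hf) mulgA. Qed.

HB.instance Definition _ := isSemigroup.Build salg salg_mulA.

Lemma salg_mulDl (x y z : salg) :
  ((x + y)%R * z)%g = (x * z)%g + (y * z)%g.
Proof. by apply: salg_ext => A f hf; rewrite !(salg_evalE hf) starmulDl. Qed.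

Lemma salg_mulDr (x y z : salg) :
  (x * (y + z)%R)%g = (x * y)%g + (x * z)%g.
Proof. by apply: salg_ext => A f hf; rewrite !(salg_evalE hf) starmulDr. Qed.

Lemma salg_mulZl (k : K) (x y : salg) :
  ((k *: x)%R * y)%g = k *: (x * y)%g.
Proof. by apply: salg_ext => A f hf; rewrite !(salg_evalE hf) starmulZl. Qed.

Lemma salg_mulZr (k : K) (x y : salg) :
  (x * (k *: y)%R)%g = k *: (x * y)%g.
Proof. by apply: salg_ext => A f hf; rewrite !(salg_evalE hf) starmulZr. Qed.

Lemma salg_starD : {morph salg_star : x y / x + y}.
Proof. by move=> x y; apply: salg_ext => A f hf; rewrite !(salg_evalE hf) starD. Qed.

Lemma salg_starZ (k : K) (x : salg) :
  salg_star (k *: x) = invol k *: salg_star x.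
Proof. by apply: salg_ext => A f hf; rewrite !(salg_evalE hf) starZ. Qed.

Lemma salg_starM (x y : salg) :
  salg_star (x * y)%g = (salg_star y * salg_star x)%g.
Proof. by apply: salg_ext => A f hf; rewrite !(salg_evalE hf) starM. Qed.

Lemma salg_starK : involutive salg_star.
Proof. by move=> x; apply: salg_ext => A f hf; rewrite !(salg_evalE hf) starK. Qed.

HB.instance Definition _ := isStarAlgebra.Build K salg
  salg_mulDl salg_mulDr salg_mulZl salg_mulZr
  salg_starD salg_starZ salg_starM salg_starK.

Lemma seval_gen t : seval salg_gen t = salg_pi t.
Proof.
by elim: t => [x||t IHt u IHu|k t IHt|t IHt u IHu|t IHt] //=;
  rewrite ?IHt ?IHu; apply: salg_ext => A f hf;
  rewrite !(salg_evalE hf) !(salg_eval_pi _ hf).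
Qed.

Lemma salg_gen_satisfies : star_satisfies salg_gen.
Proof.
by move=> t u tu; rewrite !seval_gen; apply/salg_piP => A f hf; exact: hf.
Qed.

Lemma salg_lift (A : starAlgType K) (f : X -> A) : star_satisfies f ->
  exists! g : salg -> A, star_hom g /\ forall x, g (salg_gen x) = f x.
Proof.
move=> hf; exists (salg_eval f); split.
  split; last by move=> x; rewrite salg_eval_pi.
  by split=> [k x y|x y|x]; rewrite !(salg_evalE hf).
move=> g [[gL gM gS] gX]; apply/funext => x.
have g0 : g 0 = 0.
  by have := gL (-1) 0 0; rewrite scaler0 addr0 scaleN1r addNr.
have gD y z : g (y + z) = g y + g z.
  by have := gL 1 y z; rewrite !scale1r.
have gZ k y : g (k *: y) = k *: g y.
  by have := gL k y 0; rewrite g0 !addr0.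
rewrite -[in RHS](salg_reprK x) -seval_gen /salg_eval.
by elim: (salg_repr x) => [y||t IHt u IHu|k t IHt|t IHt u IHu|t IHt] //=;
  rewrite ?gX ?g0 ?gD ?gZ ?gM ?gS ?IHt ?IHu.
Qed.

End PresentedStarAlgebra.

Definition star_ideal (K : involComPzRingType) (A : starAlgType K)
    (I : set A) : Prop :=
  [/\ I 0, forall x y, I x -> I y -> I (x + y), forall (k : K) x, I x -> I (k *: x),
      forall a x, I x -> I (a * x)%g /\ I (x * a)%g
    & forall x, I x -> I (star x)].

Definition star_ideal_gen (K : involComPzRingType) (A : starAlgType K)
    (G : set A) : set A :=
  \bigcap_(I in [set I | star_ideal I /\ G `<=` I]) I.

(* The quotient of A by the *-ideal generated by G; [squot_projP] and
   [squot_kerP] characterise it. *)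
Section StarQuotient.
Variables (K : involComPzRingType) (A : starAlgType K) (G : set A).

Let I : set A := star_ideal_gen G.

Lemma star_ideal_gen_ideal : star_ideal I.
Proof.
split.
- by move=> J [[]].
- by move=> x y Ix Iy J JG; case: (JG) => -[_ h _ _ _] _; apply: h;
    [exact: Ix|exact: Iy].
- by move=> k x Ix J JG; case: (JG) => -[_ _ h _ _] _; apply: h; exact: Ix.
- move=> a x Ix; split=> J JG; case: (JG) => -[_ _ _ h _] _.
    by case: (h a x (Ix J JG)).
  by case: (h a x (Ix J JG)).
- by move=> x Ix J JG; case: (JG) => -[_ _ _ _ h] _; apply: h; exact: Ix.
Qed.

Let I0 : I 0. Proof. by case: star_ideal_gen_ideal. Qed.
Let ID x y : I x -> I y -> I (x + y).
Proof. by case: star_ideal_gen_ideal => _ h _ _ _; exact: h. Qed.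
Let IZ (k : K) x : I x -> I (k *: x).
Proof. by case: star_ideal_gen_ideal => _ _ h _ _; exact: h. Qed.
Let IMl a x : I x -> I (a * x)%g.
Proof. by case: star_ideal_gen_ideal => _ _ _ h _ /(h a)[]. Qed.
Let IMr a x : I x -> I (x * a)%g.
Proof. by case: star_ideal_gen_ideal => _ _ _ h _ /(h a)[]. Qed.
Let IS x : I x -> I (star x).
Proof. by case: star_ideal_gen_ideal => _ _ _ _ h; exact: h. Qed.
Let IN x : I x -> I (- x).
Proof. by move=> /(@IZ (-1)); rewrite scaleN1r. Qed.

Definition squot_eqvb (x y : A) : bool := `[< I (x - y) >].

Lemma squot_eqvb_equiv : equiv_class_of squot_eqvb.
Proof.
split=> [x|x y|y x z].
- by apply/asboolP; rewrite subrr.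
- by apply/asboolP/asboolP => /IN; rewrite opprB.
- move=> /asboolP xy /asboolP yz; apply/asboolP.
  by have := ID xy yz; rewrite addrA subrK.
Qed.

Canonical squot_eqvb_rel := EquivRelPack squot_eqvb_equiv.

Definition squot : Type := {eq_quot squot_eqvb}%qT.
HB.instance Definition _ := Choice.copy squot {eq_quot squot_eqvb}%qT.

Definition squot_proj (x : A) : squot := \pi_({eq_quot squot_eqvb}%qT) x.
Definition squot_repr (x : squot) : A := repr (x : {eq_quot squot_eqvb}%qT).

Lemma squot_reprK x : squot_proj (squot_repr x) = x.
Proof. exact: reprK. Qed.

Lemma squot_projE x y : squot_proj x = squot_proj y <-> I (x - y).
Proof.
split=> [h|h]; first by apply/asboolP; exact/(@eqmodP _ squot_eqvb_rel).
by apply/(@eqmodP _ squot_eqvb_rel)/asboolP.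
Qed.

Let IR x : I (squot_repr (squot_proj x) - x).
Proof. by apply/squot_projE; rewrite squot_reprK. Qed.

Definition squot_add (x y : squot) :=
  squot_proj (squot_repr x + squot_repr y).
Definition squot_opp (x : squot) := squot_proj (- squot_repr x).
Definition squot_scale (k : K) (x : squot) := squot_proj (k *: squot_repr x).
Definition squot_mul (x y : squot) :=
  squot_proj (squot_repr x * squot_repr y)%g.
Definition squot_star (x : squot) := squot_proj (star (squot_repr x)).

Lemma squot_projD x y :
  squot_proj (x + y) = squot_add (squot_proj x) (squot_proj y).
Proof.
apply/esym/squot_projE; have := ID (IR x) (IR y).
by rewrite addrACA -opprD.
Qed.

Lemma squot_projN x : squot_proj (- x) = squot_opp (squot_proj x).
Proof. by apply/esym/squot_projE; rewrite -opprD; exact: (IN (IR x)). Qed.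

Lemma squot_projZ k x : squot_proj (k *: x) = squot_scale k (squot_proj x).
Proof. by apply/esym/squot_projE; rewrite -scalerBr; exact: (IZ k (IR x)). Qed.

Lemma squot_projM x y :
  squot_proj (x * y)%g = squot_mul (squot_proj x) (squot_proj y).
Proof.
apply/esym/squot_projE; set x' := squot_repr _; set y' := squot_repr _.
have -> : (x' * y')%g - (x * y)%g = ((x' - x)%R * y')%g + (x * (y' - y)%R)%g.
  rewrite starmulDl starmulDr -!scaleN1r starmulZl starmulZr !scaleN1r.
  by rewrite addrA subrK.
by apply: ID; [apply: IMr; exact: IR|apply: IMl; exact: IR].
Qed.

Lemma squot_projS x : squot_proj (star x) = squot_star (squot_proj x).
Proof.
apply/esym/squot_projE; have := IS (IR x).
have involN1 : invol (-1 : K) = -1.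
  have i0 : invol (0 : K) = 0.
    by apply: (addrI (invol 0)); rewrite -involD !addr0.
  have i1 : invol (1 : K) = 1.
    by have := involM (invol 1 : K) 1; rewrite mulr1 involK mul1r.
  by apply: (addrI (invol 1)); rewrite -involD subrr i0 i1 subrr.
by rewrite starD -scaleN1r starZ involN1 scaleN1r.
Qed.

Lemma squotW (P : squot -> Prop) : (forall x, P (squot_proj x)) -> forall x, P x.
Proof. by move=> h x; rewrite -[x]squot_reprK. Qed.

Lemma squot_addA : associative squot_add.
Proof.
elim/squotW=> x; elim/squotW=> y; elim/squotW=> z.
by rewrite -!squot_projD addrA.
Qed.

Lemma squot_addC : commutative squot_add.
Proof.
by elim/squotW=> x; elim/squotW=> y; rewrite -!squot_projD addrC.
Qed.

Lemma squot_add0 : left_id (squot_proj 0) squot_add.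
Proof. by elim/squotW=> x; rewrite -squot_projD add0r. Qed.

Lemma squot_addN : left_inverse (squot_proj 0) squot_opp squot_add.
Proof. by elim/squotW=> x; rewrite -squot_projN -squot_projD addNr. Qed.

HB.instance Definition _ :=
  GRing.isZmodule.Build squot squot_addA squot_addC squot_add0 squot_addN.

Lemma squot_scaleA k l x :
  squot_scale k (squot_scale l x) = squot_scale (k * l) x.
Proof. by elim/squotW: x => x; rewrite -!squot_projZ scalerA. Qed.

Lemma squot_scale1 : left_id 1 squot_scale.
Proof. by elim/squotW=> x; rewrite -squot_projZ scale1r. Qed.

Lemma squot_scaleDr : right_distributive squot_scale +%R.
Proof.
move=> k; elim/squotW=> x; elim/squotW=> y.
by rewrite -[_ + _]squot_projD -!squot_projZ -[RHS]squot_projD scalerDr.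
Qed.

Lemma squot_scaleDl x : {morph squot_scale^~ x : k l / k + l}.
Proof.
move=> k l /=; elim/squotW: x => x.
by rewrite -!squot_projZ -[RHS]squot_projD scalerDl.
Qed.

HB.instance Definition _ := GRing.Zmodule_isLmodule.Build K squot
  squot_scaleA squot_scale1 squot_scaleDr squot_scaleDl.

Lemma squot_mulA : associative squot_mul.
Proof.
elim/squotW=> x; elim/squotW=> y; elim/squotW=> z.
by rewrite -!squot_projM mulgA.
Qed.

HB.instance Definition _ := isSemigroup.Build squot squot_mulA.

Lemma squot_mulDl (x y z : squot) :
  ((x + y)%R * z)%g = (x * z)%g + (y * z)%g.
Proof.
elim/squotW: x => x; elim/squotW: y => y; elim/squotW: z => z.
rewrite -[(_ + _)%R in LHS]squot_projD -[LHS]squot_projM.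
by rewrite -[(squot_proj x * _)%g]squot_projM -[(squot_proj y * _)%g]squot_projM
  -[RHS]squot_projD starmulDl.
Qed.

Lemma squot_mulDr (x y z : squot) :
  (x * (y + z)%R)%g = (x * y)%g + (x * z)%g.
Proof.
elim/squotW: x => x; elim/squotW: y => y; elim/squotW: z => z.
rewrite -[(_ + _)%R in LHS]squot_projD -[LHS]squot_projM.
by rewrite -[(_ * squot_proj y)%g]squot_projM -[(_ * squot_proj z)%g]squot_projM
  -[RHS]squot_projD starmulDr.
Qed.

Lemma squot_mulZl (k : K) (x y : squot) :
  ((k *: x)%R * y)%g = k *: (x * y)%g.
Proof.
elim/squotW: x => x; elim/squotW: y => y.
rewrite -[(k *: squot_proj x)%R]squot_projZ -[LHS]squot_projM starmulZl.
by rewrite squot_projZ squot_projM.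
Qed.

Lemma squot_mulZr (k : K) (x y : squot) :
  (x * (k *: y)%R)%g = k *: (x * y)%g.
Proof.
elim/squotW: x => x; elim/squotW: y => y.
rewrite -[(k *: squot_proj y)%R]squot_projZ -[LHS]squot_projM starmulZr.
by rewrite squot_projZ squot_projM.
Qed.

Lemma squot_starD : {morph squot_star : x y / x + y}.
Proof.
elim/squotW=> x; elim/squotW=> y.
by rewrite -[(_ + _)%R in LHS]squot_projD -!squot_projS -[RHS]squot_projD starD.
Qed.

Lemma squot_starZ (k : K) (x : squot) :
  squot_star (k *: x) = invol k *: squot_star x.
Proof.
elim/squotW: x => x.
by rewrite -[(k *: _)%R]squot_projZ -!squot_projS -[RHS]squot_projZ starZ.
Qed.

Lemma squot_starM (x y : squot) :
  squot_star (x * y)%g = (squot_star y * squot_star x)%g.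
Proof.
elim/squotW: x => x; elim/squotW: y => y.
by rewrite -[(_ * _)%g in LHS]squot_projM -!squot_projS -[RHS]squot_projM starM.
Qed.

Lemma squot_starK : involutive squot_star.
Proof. by elim/squotW=> x; rewrite -!squot_projS starK. Qed.

HB.instance Definition _ := isStarAlgebra.Build K squot
  squot_mulDl squot_mulDr squot_mulZl squot_mulZr
  squot_starD squot_starZ squot_starM squot_starK.

Lemma squot_projP :
  star_hom squot_proj /\ forall y, exists x, squot_proj x = y.
Proof.
split; last by move=> y; exists (squot_repr y); exact: squot_reprK.
split=> [k x y|x y|x]; [|exact: squot_projM|exact: squot_projS].
by rewrite [LHS]squot_projD squot_projZ.
Qed.

Lemma squot_kerP x : squot_proj x = 0 <-> star_ideal_gen G x.
Proof. by rewrite -[0]/(squot_proj 0) squot_projE subr0. Qed.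

End StarQuotient.

Section SepGraphSemigroup.
Variable E : sepgraph.

Let V (v : vtx E) : isterm (vtx E + hedg E) := IVar (inl v).
Let H (x : hedg E) : isterm (vtx E + hedg E) := IVar (inr x).

Inductive sepgraph_sgp_rel : isterm (vtx E + hedg E) -> isterm (vtx E + hedg E) -> Prop :=
| sg_vv v : sepgraph_sgp_rel (IMul (V v) (V v)) (V v)
| sg_vw v w : v <> w -> sepgraph_sgp_rel (IMul (V v) (V w)) IZero
| sg_src x : sepgraph_sgp_rel (IMul (V (hsrc x)) (H x)) (H x)
| sg_rng x : sepgraph_sgp_rel (IMul (H x) (V (hrng x))) (H x)
| sg_ee v X e : cls v X -> X e ->
    sepgraph_sgp_rel (IMul (H (inr e)) (H (inl e))) (V (rng e))
| sg_ef v X e f : cls v X -> X e -> X f -> e <> f ->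
    sepgraph_sgp_rel (IMul (H (inr e)) (H (inl f))) IZero.

Definition sepgraph_sgp : invSemigroup0Type := isgp sepgraph_sgp_rel.

End SepGraphSemigroup.

Section CohnPathAlgebra.
Variables (K : involComPzRingType) (E : sepgraph).

Let V (v : vtx E) : sterm K (vtx E + edg E) := SVar (inl v).
Let D (e : edg E) : sterm K (vtx E + edg E) := SVar (inr e).

Inductive cohn_rel : sterm K (vtx E + edg E) -> sterm K (vtx E + edg E) -> Prop :=
| cohn_sa v : cohn_rel (SStar (V v)) (V v)
| cohn_vv v : cohn_rel (SMul (V v) (V v)) (V v)
| cohn_vw v w : v <> w -> cohn_rel (SMul (V v) (V w)) SZero
| cohn_src e : cohn_rel (SMul (V (src e)) (D e)) (D e)
| cohn_rng e : cohn_rel (SMul (D e) (V (rng e))) (D e)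
| cohn_star_src e : cohn_rel (SMul (SStar (D e)) (V (src e))) (SStar (D e))
| cohn_star_rng e : cohn_rel (SMul (V (rng e)) (SStar (D e))) (SStar (D e))
| cohn_ee v X e : cls v X -> X e ->
    cohn_rel (SMul (SStar (D e)) (D e)) (V (rng e))
| cohn_ef v X e f : cls v X -> X e -> X f -> e <> f ->
    cohn_rel (SMul (SStar (D e)) (D f)) SZero.

Definition cohn_alg : starAlgType K := salg cohn_rel.

Inductive star_words : set cohn_alg :=
| sw_gen x : star_words (salg_gen cohn_rel x)
| sw_mul x y : star_words x -> star_words y -> star_words (x * y)%g
| sw_star x : star_words x -> star_words (star x).

Definition tame_commutators : set cohn_alg :=
  [set c | exists x y, [/\ star_words x, star_words y &
     c = ((x * star x) * (y * star y))%g - ((y * star y) * (x * star x))%g]].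

Definition tame_cohn_alg : starAlgType K := squot tame_commutators.

End CohnPathAlgebra.

Arguments star_words K E _ : clear implicits.
Arguments tame_commutators K E _ : clear implicits.

Section SemigroupAlgebra.
Variables (K : involComPzRingType) (S : invSemigroup0Type).

Inductive sgp_alg_rel : sterm K S -> sterm K S -> Prop :=
| sga_zero : sgp_alg_rel (SVar zeros) SZero
| sga_mul s t : sgp_alg_rel (SVar (s * t)%g) (SMul (SVar s) (SVar t))
| sga_inv s : sgp_alg_rel (SVar (invs s)) (SStar (SVar s)).

Definition sgp_alg : starAlgType K := salg sgp_alg_rel.

End SemigroupAlgebra.

(* The norm takes its values in the nonnegative elements of R[i]. *)
HB.mixin Record isCstarAlgebra (R : realType) A
    of StarAlgebra R[i] A & CompleteNormedModule R[i] A := {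
  cstar_normM : forall x y : A, `|(x * y)%g| <= `|x| * `|y|;
  cstar_normE : forall x : A, `|(star x * x)%g| = `|x| ^+ 2 }.

#[short(type="cstarAlgType")]
HB.structure Definition CstarAlgebra (R : realType) :=
  {A of isCstarAlgebra R A & StarAlgebra R[i] A & CompleteNormedModule R[i] A}.

(* B, with the map iota, is the enveloping C*-algebra of A. *)
Definition is_enveloping (R : realType) (A : starAlgType R[i])
    (B : cstarAlgType R) (iota : A -> B) : Prop :=
  star_hom iota /\
  forall (D : cstarAlgType R) (phi : A -> D), star_hom phi ->
    exists! psi : B -> D, star_hom psi /\ psi \o iota = phi.

Definition closed_ideal (R : realType) (A : cstarAlgType R) (J : set A) : Prop :=
  [/\ closed J, J 0, forall x y, J x -> J y -> J (x + y),
      forall (k : R[i]) x, J x -> J (k *: x)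
    & forall a x, J x -> J (a * x)%g /\ J (x * a)%g].

Definition closed_ideal_gen (R : realType) (A : cstarAlgType R) (G : set A) : set A :=
  \bigcap_(J in [set J | closed_ideal J /\ G `<=` J]) J.

(* B, with the map q, is the quotient C*-algebra A / J.  Its norm is then the
   quotient norm, since injective *-homomorphisms of C*-algebras are isometric;
   for the same reason star_iso is isomorphism of C*-algebras. *)
Definition is_quotient (R : realType) (A B : cstarAlgType R)
    (J : set A) (q : A -> B) : Prop :=
  [/\ star_hom q, forall y, exists x, q x = y & forall x, q x = 0 <-> J x].

Definition is_toeplitz_path_alg (R : realType) (E : sepgraph)
    (TP : cstarAlgType R) (iota : cohn_alg R[i] E -> TP) : Prop :=
  is_enveloping iota.

Definition is_toeplitz_alg (R : realType) (E : sepgraph)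
    (T : cstarAlgType R) : Prop :=
  exists (TP : cstarAlgType R) (iota : cohn_alg R[i] E -> TP) (q : TP -> T),
    is_toeplitz_path_alg iota /\
    is_quotient (closed_ideal_gen (iota @` tame_commutators R[i] E)) q.

Definition is_sgp_cstar_alg (R : realType) (S : invSemigroup0Type)
    (B : cstarAlgType R) : Prop :=
  exists iota : sgp_alg R[i] S -> B, is_enveloping iota.

(* Main.v *)
From HB Require Import structures.
Require Import Defs.
From mathcomp Require Import all_boot all_order all_algebra complex.
From mathcomp Require Import all_classical all_reals all_analysis.
From mathcomp Require Import zify ring.

(** The algebraic isomorphism matches two universal properties.

    From the Cohn path algebra to K[S], send a vertex or an edge to the
    corresponding element of S = S(E,C).  The generator e^{-1} is the inverse
    of e in S ([sg_edg_inv]), so the star is respected, and a word in the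
    generators and their stars goes to an element s of S.  Hence x x^* goes to
    the idempotent s s^{-1}.  Idempotents of an inverse semigroup commute
    ([idem_comm]), so the map kills the tame commutators and factors through
    the tame algebra.

    From K[S] to the tame algebra, what is needed is an inverse semigroup
    inside the tame algebra.  Once the projections x x^* commute, a product of
    partial isometries is again one, so every word in the generators is a
    partial isometry ([tame_word_partial_isometry]).  A star-closed semigroup
    of partial isometries whose range projections commute is an inverse
    semigroup ([pisgp_inv_uniq]), and the universal property of S maps S into
    it.  The two homomorphisms are inverse to each other on generators.

    For the C*-algebras, universal properties give alpha : TP -> C*(S) and
    beta : C*(S) -> T, and alpha kills the commutators.  That alpha descends to
    T, the inverse of beta, requires its kernel to be closed: this is the
    automatic continuity of *-homomorphisms ([star_hom_ker_closed]), the one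
    point where analysis enters.  The proof goes as follows.  If x is a limit
    of elements of the kernel of f, then f x is the image of arbitrarily small
    elements, and so is every multiple z c of the self-adjoint element
    c = (f x)^* (f x).  By the Neumann series, 1 - z c then has a left inverse
    for every complex z.  It remains to see that such a c is 0, that is, that
    the spectral radius of c is its norm ([selfadj_entire_resolvent_eq0]).

    Suppose |c| = 1.  The resolvent of c is bounded, hence Lipschitz, on the
    unit disc.  Averaging over the two square roots of w,

      (1 - w c^2)^{-1} = ((1 - z c)^{-1} + (1 + z c)^{-1}) / 2,   z^2 = w,

    carries the estimate from c to c^2, the points w and s w of the resolvent
    becoming w and s^2 w, with the same constants ([resolvent_close_sqr]).
    After n steps, the resolvent of p = c^(2^n) at 1 is close to its value at
    t^(2^n), which is close to 1.  Applied to (1 - p) p, the resolvent at 1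
    gives p, so p is close to p - p^2, and p^2 is small.  But p^2 has norm 1 by
    the C*-identity. *)

Set Implicit Arguments.
Unset Strict Implicit.
Unset Printing Implicit Defensive.

Import Order.TTheory GRing.Theory Num.Theory.
Import numFieldNormedType.Exports.

Local Open Scope classical_set_scope.
Local Open Scope ring_scope.

(** * *-algebras and *-homomorphisms *)

Section StarAlgebraTheory.
Variables (K : involComPzRingType) (A : starAlgType K).
Implicit Types x y z : A.

Lemma starmul0l x : (0%R * x)%g = 0%R :> A.
Proof. by rewrite -[0%R in LHS](scale0r (0 : A)) starmulZl scale0r. Qed.

Lemma starmul0r x : (x * 0%R)%g = 0%R :> A.
Proof. by rewrite -[0%R in LHS](scale0r (0 : A)) starmulZr scale0r. Qed.

Lemma starmulNl x y : ((- x)%R * y)%g = - (x * y)%g.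
Proof. by rewrite -scaleN1r starmulZl scaleN1r. Qed.

Lemma starmulNr x y : (x * (- y)%R)%g = - (x * y)%g.
Proof. by rewrite -scaleN1r starmulZr scaleN1r. Qed.

Lemma starmulBl x y z : ((x - y)%R * z)%g = (x * z)%g - (y * z)%g.
Proof. by rewrite starmulDl starmulNl. Qed.

Lemma starmulBr x y z : (x * (y - z)%R)%g = (x * y)%g - (x * z)%g.
Proof. by rewrite starmulDr starmulNr. Qed.

Lemma star0 : star (0%R : A) = 0.
Proof. by apply: (addrI (star 0)); rewrite -starD !addr0. Qed.

End StarAlgebraTheory.

Section StarHom.
Variables (K : involComPzRingType) (A B : starAlgType K).

Lemma star_hom0 (f : A -> B) : star_hom f -> f 0 = 0.
Proof. by case=> fL _ _; have := fL (-1) 0 0; rewrite scaler0 addr0 scaleN1r addNr. Qed.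

Lemma star_homD (f : A -> B) : star_hom f -> {morph f : x y / x + y}.
Proof. by case=> fL _ _ x y; have := fL 1 x y; rewrite !scale1r. Qed.

Lemma star_homZ (f : A -> B) k : star_hom f -> {morph f : x / k *: x}.
Proof.
by move=> fh x; have [fL _ _] := fh; have := fL k x 0; rewrite star_hom0 // !addr0.
Qed.

Lemma star_homB (f : A -> B) : star_hom f -> {morph f : x y / x - y}.
Proof.
by move=> fh x y; rewrite star_homD // -scaleN1r star_homZ // scaleN1r.
Qed.

Lemma star_hom_can (f : A -> B) (g : B -> A) :
  star_hom f -> cancel f g -> cancel g f -> star_hom g.
Proof.
move=> [fL fM fS] fK gK; split=> [k x y|x y|x]; apply: (can_inj fK).
- by rewrite fL !gK.
- by rewrite fM !gK.
- by rewrite fS !gK.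
Qed.

Lemma star_hom_ker_ideal (f : A -> B) : star_hom f -> star_ideal [set x | f x = 0].
Proof.
move=> fh; have [_ fM fS] := fh; split=> /=.
- exact: star_hom0.
- by move=> x y fx fy; rewrite star_homD // fx fy addr0.
- by move=> k x fx; rewrite star_homZ // fx scaler0.
- by move=> a x fx; rewrite !fM fx starmul0l starmul0r.
- by move=> x fx; rewrite fS fx star0.
Qed.

End StarHom.

Section StarHomComposition.
Variables (K : involComPzRingType) (A B D : starAlgType K).

Lemma star_hom_comp (g : B -> D) (f : A -> B) :
  star_hom g -> star_hom f -> star_hom (g \o f).
Proof.
move=> [gL gM gS] [fL fM fS]; split=> [k x y|x y|x] /=.
- by rewrite fL gL.
- by rewrite fM gM.
- by rewrite fS gS.
Qed.

(** The fundamental homomorphism theorem; it serves both for the quotient by a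
    *-ideal and for an abstract quotient C*-algebra. *)
Lemma star_hom_factor (p : A -> B) (f : A -> D) :
  star_hom p -> (forall y, exists x, p x = y) -> star_hom f ->
  (forall x, p x = 0 -> f x = 0) ->
  exists2 g : B -> D, star_hom g & forall x, g (p x) = f x.
Proof.
move=> ph psurj fh pf; have [r rK] := choice psurj.
have gE x : f (r (p x)) = f x.
  by apply/subr0_eq; rewrite -(star_homB fh) pf // (star_homB ph) rK subrr.
exists (f \o r) => //=; have [pL pM pS] := ph; have [fL fM fS] := fh.
by split=> [k x y|x y|x] /=; rewrite -1?[x]rK -1?[y]rK -?pL -?pM -?pS !gE
  ?fL ?fM ?fS.
Qed.

End StarHomComposition.

Lemma squot_lift (K : involComPzRingType) (A B : starAlgType K) (G : set A)
    (f : A -> B) : star_hom f -> (forall x, G x -> f x = 0) ->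
  exists2 g : squot G -> B, star_hom g & forall x, g (squot_proj G x) = f x.
Proof.
move=> fh fG; have [ph psurj] := squot_projP G.
apply: star_hom_factor => // x /squot_kerP Gx; apply: (Gx [set x | f x = 0]).
by split; [exact: star_hom_ker_ideal|exact: fG].
Qed.

Lemma salg_hom_ext (K : involComPzRingType) (X : Type)
    (rel : sterm K X -> sterm K X -> Prop) (A : starAlgType K)
    (f g : salg rel -> A) : star_hom f -> star_hom g ->
  (forall x, f (salg_gen rel x) = g (salg_gen rel x)) -> f =1 g.
Proof.
move=> fh gh fg x; rewrite -[x]salg_reprK -seval_gen.
have [_ fM fS] := fh; have [_ gM gS] := gh.
elim: (salg_repr x) => [y||t IHt u IHu|k t IHt|t IHt u IHu|t IHt] //=.
- by rewrite !star_hom0.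
- by rewrite !star_homD // IHt IHu.
- by rewrite !star_homZ // IHt.
- by rewrite fM gM IHt IHu.
- by rewrite fS gS IHt.
Qed.

(** * Inverse semigroups *)

Section InverseSemigroupTheory.
Variable S : invSemigroup0Type.
Implicit Types x y e f : S.

Lemma invs_idem e : (e * e = e)%g -> invs e = e.
Proof. by move=> ee; apply/esym/invs_uniq; rewrite !ee. Qed.

Lemma mulsV_idem x : (x * invs x * (x * invs x) = x * invs x)%g.
Proof. by rewrite mulgA mulsVs. Qed.

Lemma idemK e x : (e * e = e)%g -> (e * (e * x) = e * x)%g.
Proof. by move=> ee; rewrite mulgA ee. Qed.

(** If g is the inverse of e f, then f g e is another one, so g = f g e; this
    makes g idempotent, and g is then its own inverse. *)
Lemma idem_mul_idem e f :
  (e * e = e)%g -> (f * f = f)%g -> (e * f * (e * f) = e * f)%g.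
Proof.
move=> ee ff; set g := invs (e * f)%g.
have := mulsVs (e * f)%g; have := mulVsV (e * f)%g.
rewrite -/g -!mulgA => gxg xgx.
have gE : (f * (g * e) = g)%g.
  apply: invs_uniq; rewrite -!mulgA !(idemK _ ee) !(idemK _ ff) //.
  by congr (f * _)%g; rewrite -[in RHS]gxg -!mulgA.
have gg : (g * g = g)%g.
  transitivity ((f * (g * e)) * (f * (g * e)))%g; first by rewrite gE.
  by rewrite -[RHS]gE -[in RHS]gxg -!mulgA.
have xE : (e * f = g)%g.
  by rewrite -(invs_idem gg); apply: invs_uniq; rewrite -!mulgA.
by rewrite mulgA !xE gg.
Qed.

(** Both products are idempotent, so e f is its own inverse; f e is inverse to
    it as well. *)
Lemma idem_comm e f : (e * e = e)%g -> (f * f = f)%g -> (e * f = f * e)%g.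
Proof.
move=> ee ff; have ef := idem_mul_idem ee ff; have fe := idem_mul_idem ff ee.
rewrite -(invs_idem ef); apply/esym/invs_uniq; rewrite -!mulgA.
  by rewrite !(idemK _ ee) !(idemK _ ff) mulgA.
by rewrite !(idemK _ ee) !(idemK _ ff) mulgA.
Qed.

End InverseSemigroupTheory.

(** * Semigroups of partial isometries *)

Record partial_isometry_sgp (K : involComPzRingType) (A : starAlgType K)
    (W : set A) : Prop := PartialIsometrySgp {
  pisgp_0 : W 0;
  pisgp_M : forall x y, W x -> W y -> W (x * y)%g;
  pisgp_S : forall x, W x -> W (star x);
  pisgp_pi : forall x, W x -> (x * star x * x = x)%g;
  pisgp_comm : forall x y, W x -> W y ->
    ((x * star x) * (y * star y) = (y * star y) * (x * star x))%g }.

Section PartialIsometrySemigroup.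
Variables (K : involComPzRingType) (A : starAlgType K) (W : set A).
Hypothesis hW : partial_isometry_sgp W.
Implicit Types x y u v : A.

(** For idempotent u one has u^* = (u^* u)(u u^* ); commuting the two
    projections gives u u^* u^* u = u. *)
Lemma pisgp_idem u : W u -> (u * u = u)%g -> star u = u.
Proof.
move=> Wu uu; have Wu' := pisgp_S hW Wu.
have uu' : (star u * star u = star u)%g by rewrite -starM uu.
have comm := pisgp_comm hW Wu Wu'; rewrite starK in comm.
rewrite -{1}(pisgp_pi hW Wu') starK.
transitivity ((star u * u) * (u * star u))%g.
  by rewrite !mulgA -(mulgA _ u u) uu.
rewrite -comm !mulgA -(mulgA u _ (star u)) uu'.
exact: (pisgp_pi hW Wu).
Qed.

Lemma pisgp_idem_comm u v : W u -> W v ->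
  (u * u = u)%g -> (v * v = v)%g -> (u * v = v * u)%g.
Proof.
move=> Wu Wv uu vv; have := pisgp_comm hW Wu Wv.
by rewrite !pisgp_idem // uu vv.
Qed.

(** The idempotents x y and x x^* have the same range, and y x and x^* x the
    same kernel; as they commute, they are equal.  Hence
    y = y x y = y x x^* = x^* x x^* = x^*. *)
Lemma pisgp_inv_uniq x y : W x -> W y ->
  (x * y * x = x)%g -> (y * x * y = y)%g -> y = star x.
Proof.
move=> Wx Wy xyx yxy; have Wx' := pisgp_S hW Wx.
have xx'x := pisgp_pi hW Wx.
have x'xx' : (star x * x * star x = star x)%g.
  by have := pisgp_pi hW Wx'; rewrite starK.
have h1 : (x * star x = x * y)%g.
  have : (x * y * (x * star x) = x * star x * (x * y))%g.
    apply: pisgp_idem_comm; rewrite ?mulgA ?xyx ?xx'x //; exact: (pisgp_M hW).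
  by rewrite !mulgA xyx xx'x.
have h2 : (y * x = star x * x)%g.
  have : (star x * x * (y * x) = y * x * (star x * x))%g.
    apply: pisgp_idem_comm; rewrite ?mulgA ?yxy ?x'xx' //; exact: (pisgp_M hW).
  by rewrite -!mulgA [(x * (y * x))%g]mulgA xyx [(x * (star x * x))%g]mulgA xx'x.
by rewrite -yxy -mulgA -h1 mulgA h2 x'xx'.
Qed.

(** The proof that W is a semigroup of partial isometries is a parameter of the
    type, so that it can be recovered from the type when instances are sought. *)
Definition pisgp & partial_isometry_sgp W : Type := {x : A | `[< W x >]}.
Local Notation T := (pisgp hW).
HB.instance Definition _ := Choice.copy T {x : A | `[< W x >]}.

Definition pisgp_val (x : T) : A := sval x.
Definition pisgp_of x (Wx : W x) : T := exist _ x (asboolT Wx).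

Lemma pisgpP (x : T) : W (pisgp_val x).
Proof. exact: asboolW (svalP x). Qed.

Lemma pisgp_val_inj : injective pisgp_val.
Proof. exact: val_inj. Qed.

Definition pisgp_zero : T := pisgp_of (pisgp_0 hW).
Definition pisgp_mul (x y : T) : T := pisgp_of (pisgp_M hW (pisgpP x) (pisgpP y)).
Definition pisgp_inv (x : T) : T := pisgp_of (pisgp_S hW (pisgpP x)).

Lemma pisgp_mulA : associative pisgp_mul.
Proof. by move=> x y z; apply: pisgp_val_inj; exact: mulgA. Qed.

HB.instance Definition _ := isSemigroup.Build T pisgp_mulA.

Lemma pisgp_mul0s (x : T) : (pisgp_zero * x)%g = pisgp_zero.
Proof. by apply: pisgp_val_inj; exact: starmul0l. Qed.

Lemma pisgp_muls0 (x : T) : (x * pisgp_zero)%g = pisgp_zero.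
Proof. by apply: pisgp_val_inj; exact: starmul0r. Qed.

Lemma pisgp_mulsVs (x : T) : (x * pisgp_inv x * x)%g = x.
Proof. by apply: pisgp_val_inj; apply: (pisgp_pi hW); exact: pisgpP. Qed.

Lemma pisgp_mulVsV (x : T) : (pisgp_inv x * x * pisgp_inv x)%g = pisgp_inv x.
Proof.
apply: pisgp_val_inj; have := pisgp_pi hW (pisgp_S hW (pisgpP x)).
by rewrite starK.
Qed.

Lemma pisgp_invs_uniq (x y : T) :
  (x * y * x)%g = x -> (y * x * y)%g = y -> y = pisgp_inv x.
Proof.
move=> /(congr1 pisgp_val) h /(congr1 pisgp_val) k; apply: pisgp_val_inj.
by apply: pisgp_inv_uniq h k; exact: pisgpP.
Qed.

HB.instance Definition _ := isInvSemigroup0.Build T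
  pisgp_mul0s pisgp_muls0 pisgp_mulsVs pisgp_mulVsV pisgp_invs_uniq.

End PartialIsometrySemigroup.

(** The form in which semigroups of partial isometries are used: a map of the
    generators into W that respects the relations extends to the presented
    inverse semigroup. *)
Lemma isgp_star_lift (K : involComPzRingType) (A : starAlgType K) (W : set A)
    (hW : partial_isometry_sgp W) (X : Type) (rel : isterm X -> isterm X -> Prop)
    (f : X -> A) (Wf : forall x, W (f x)) :
  is_satisfies rel (fun x => pisgp_of hW (Wf x)) ->
  exists g : isgp rel -> A,
    [/\ forall x, g (isgp_gen rel x) = f x, g zeros = 0,
        {morph g : x y / (x * y)%g} & forall x, g (invs x) = star (g x)].
Proof.
move=> /isgp_lift[g [[gX g0 gM gV] _]].
exists (fun x => pisgp_val (g x)); split=> [x||x y|x].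
- by rewrite gX.
- by rewrite g0.
- by rewrite gM.
- by rewrite gV.
Qed.

(** * The tame Cohn path algebra and the semigroup algebra *)

Section SemigroupAlgebraTheory.
Variables (K : involComPzRingType) (S : invSemigroup0Type).

Definition sga (s : S) : sgp_alg K S := salg_gen (@sgp_alg_rel K S) s.

Lemma sga0 : sga zeros = 0.
Proof. exact: (salg_gen_satisfies (sga_zero K S)). Qed.

Lemma sgaM (s t : S) : sga (s * t)%g = (sga s * sga t)%g.
Proof. exact: (salg_gen_satisfies (sga_mul K s t)). Qed.

Lemma sgaV (s : S) : sga (invs s) = star (sga s).
Proof. exact: (salg_gen_satisfies (sga_inv K s)). Qed.

Lemma sga_lift (A : starAlgType K) (f : S -> A) :
  f zeros = 0 -> {morph f : s t / (s * t)%g} ->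
  (forall s, f (invs s) = star (f s)) ->
  exists2 g : sgp_alg K S -> A, star_hom g & forall s, g (sga s) = f s.
Proof.
move=> f0 fM fV.
have [|g [[gh gS] _]] := @salg_lift _ _ (@sgp_alg_rel K S) A f; last by exists g.
by move=> t u []; [exact: f0|exact: fM|exact: fV].
Qed.

End SemigroupAlgebraTheory.

Lemma edge_in_class (E : sepgraph) (e : edg E) :
  exists2 X, cls (src e) X & X e.
Proof.
have [cov _ _] := cls_partition (src e).
have : [set f : edg E | src f = src e] e by [].
by rewrite -cov => -[X]; exists X.
Qed.

Section SepGraphSemigroupTheory.
Variable E : sepgraph.

Let rel := @sepgraph_sgp_rel E.
Definition sg_vtx (v : vtx E) : sepgraph_sgp E := isgp_gen rel (inl v).
Definition sg_edg (e : edg E) : sepgraph_sgp E := isgp_gen rel (inr (inl e)).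
Definition sg_edgV (e : edg E) : sepgraph_sgp E := isgp_gen rel (inr (inr e)).

Lemma sg_rel_gen t u : rel t u -> iseval (isgp_gen rel) t = iseval (isgp_gen rel) u.
Proof. exact: isgp_gen_satisfies. Qed.

Lemma sg_vtx_inv v : invs (sg_vtx v) = sg_vtx v.
Proof. by apply: invs_idem; exact: (sg_rel_gen (sg_vv v)). Qed.

(** The defining relations give e e^{-1} e = e r(e) = e and
    e^{-1} e e^{-1} = r(e) e^{-1} = e^{-1}. *)
Lemma sg_edg_inv e : invs (sg_edg e) = sg_edgV e.
Proof.
have [X CX Xe] := edge_in_class e.
have ee : (sg_edgV e * sg_edg e)%g = sg_vtx (rng e).
  exact: (sg_rel_gen (sg_ee CX Xe)).
apply/esym/invs_uniq.
  by rewrite -mulgA ee; exact: (sg_rel_gen (sg_rng (inl e))).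
by rewrite ee; exact: (sg_rel_gen (sg_src (inr e))).
Qed.

End SepGraphSemigroupTheory.

Section TameIso.
Variables (K : involComPzRingType) (E : sepgraph).
Let S := sepgraph_sgp E.
Let rel := @sepgraph_sgp_rel E.
Let crel := @cohn_rel K E.
Let C := cohn_alg K E.
Let V v : C := salg_gen crel (inl v).
Let D e : C := salg_gen crel (inr e).

Lemma cohn_to_sga : exists2 f : C -> sgp_alg K S, star_hom f &
  (forall v, f (V v) = sga K (sg_vtx v)) /\ (forall e, f (D e) = sga K (sg_edg e)).
Proof.
pose g (x : vtx E + edg E) : sgp_alg K S :=
  match x with inl v => sga K (sg_vtx v) | inr e => sga K (sg_edg e) end.
have [|f [[fh fX] _]] := @salg_lift _ _ crel _ g; last first.
  by exists f => //; split=> x; rewrite fX.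
have R := @sg_rel_gen E.
move=> t u [v|v|v w vw|e|e|e|e|v X e CX Xe|v X e f CX Xe Xf ef] /=;
  rewrite -?sgaV ?sg_vtx_inv ?sg_edg_inv -?sgaM.
- by [].
- by congr (sga K _); exact: (R _ _ (sg_vv v)).
- by rewrite -sga0; congr (sga K _); exact: (R _ _ (sg_vw vw)).
- by congr (sga K _); exact: (R _ _ (sg_src (inl e))).
- by congr (sga K _); exact: (R _ _ (sg_rng (inl e))).
- by congr (sga K _); exact: (R _ _ (sg_rng (inr e))).
- by congr (sga K _); exact: (R _ _ (sg_src (inr e))).
- by congr (sga K _); exact: (R _ _ (sg_ee CX Xe)).
- by rewrite -sga0; congr (sga K _); exact: (R _ _ (sg_ef CX Xe Xf ef)).
Qed.

Lemma star_words_sga (f : C -> sgp_alg K S) : star_hom f ->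
  (forall v, f (V v) = sga K (sg_vtx v)) -> (forall e, f (D e) = sga K (sg_edg e)) ->
  forall x, star_words K E x -> exists s, f x = sga K s.
Proof.
move=> [_ fM fS] fV fD x; elim=> [[v|e]|{}x y _ [s xs] _ [t yt]|{}x _ [s xs]].
- by exists (sg_vtx v); exact: fV.
- by exists (sg_edg e); exact: fD.
- by exists (s * t)%g; rewrite fM sgaM xs yt.
- by exists (invs s); rewrite fS sgaV xs.
Qed.

Lemma tame_to_sga : exists2 f : tame_cohn_alg K E -> sgp_alg K S, star_hom f &
  (forall v, f (squot_proj _ (V v)) = sga K (sg_vtx v)) /\
  (forall e, f (squot_proj _ (D e)) = sga K (sg_edg e)).
Proof.
have [f fh [fV fD]] := cohn_to_sga.
have [|g gh gE] := @squot_lift _ _ _ (tame_commutators K E) _ fh; last first.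
  by exists g => //; split=> x; rewrite gE.
move=> c [x [y [Wx Wy ->]]]; have [_ fM fS] := fh.
have [s xs] := star_words_sga fh fV fD Wx.
have [t yt] := star_words_sga fh fV fD Wy.
apply/eqP; rewrite star_homB // subr_eq0; apply/eqP.
rewrite !fM !fS xs yt -!sgaV -!sgaM; congr (sga K _).
by apply: idem_comm; exact: mulsV_idem.
Qed.

Let p : C -> tame_cohn_alg K E := squot_proj _.
Let ph : star_hom p. Proof. by have [] := squot_projP (tame_commutators K E). Qed.
Let pM : {morph p : x y / (x * y)%g}. Proof. by case: ph. Qed.
Let pS : {morph p : x / star x}. Proof. by case: ph. Qed.

Lemma cohn_rel_gen t u : crel t u -> seval (salg_gen crel) t = seval (salg_gen crel) u.
Proof. exact: salg_gen_satisfies. Qed.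

Lemma tame_word_comm x y : star_words K E x -> star_words K E y ->
  (p x * star (p x) * (p y * star (p y)) = p y * star (p y) * (p x * star (p x)))%g.
Proof.
move=> Wx Wy; apply/subr0_eq; rewrite -!pS -!pM -(star_homB ph).
apply/squot_kerP => I [_]; apply; by exists x, y.
Qed.

(** In x y y^* x^* x y the projections y y^* and x^* x can be exchanged, which
    leaves (x x^* x)(y y^* y). *)
Lemma tame_word_partial_isometry x : star_words K E x ->
  (p x * star (p x) * p x = p x)%g.
Proof.
elim=> [[v|e]|{}x y Wx xP Wy yP|{}x _ xP].
- have VS : star (V v) = V v by exact: (cohn_rel_gen (cohn_sa _ v)).
  have VV : (V v * V v)%g = V v by exact: (cohn_rel_gen (cohn_vv _ v)).
  by rewrite -/(V v) -pS VS -!pM !VV.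
- have [X CX Xe] := edge_in_class e.
  have DD : (star (D e) * D e)%g = V (rng e).
    exact: (cohn_rel_gen (cohn_ee _ CX Xe)).
  have DV : (D e * V (rng e))%g = D e by exact: (cohn_rel_gen (cohn_rng _ e)).
  by rewrite -/(D e) -pS -!pM -mulgA DD DV.
- have := tame_word_comm (sw_star Wx) Wy; rewrite pS starK => comm.
  rewrite pM starM; set a := p x in xP comm *; set b := p y in yP comm *.
  transitivity (a * ((b * star b) * (star a * a)) * b)%g; first by rewrite !mulgA.
  by rewrite -comm !mulgA xP -[in RHS]yP !mulgA.
- by rewrite pS starK -[in RHS]xP !starM starK mulgA.
Qed.

(** Zero is adjoined because it is the value of e^{-1} f for distinct edges e
    and f of one class. *)
Definition tame_words0 : set (tame_cohn_alg K E) :=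
  [set x | x = 0 \/ exists2 w, star_words K E w & x = p w].

Lemma tame_words0_pisgp : partial_isometry_sgp tame_words0.
Proof.
split.
- by left.
- move=> x y [->|[u Wu ->]]; first by left; rewrite starmul0l.
  case=> [->|[v Wv ->]]; first by left; rewrite starmul0r.
  by right; exists (u * v)%g; [exact: sw_mul|rewrite pM].
- move=> x [->|[u Wu ->]]; first by left; rewrite star0.
  by right; exists (star u); [exact: sw_star|rewrite pS].
- move=> x [->|[u Wu ->]]; first by rewrite starmul0r.
  exact: tame_word_partial_isometry.
- move=> x y [->|[u Wu ->]]; first by rewrite !(starmul0l, starmul0r).
  case=> [->|[v Wv ->]]; first by rewrite !(starmul0l, starmul0r).
  exact: tame_word_comm.
Qed.

Lemma sga_to_tame : exists2 g : sgp_alg K S -> tame_cohn_alg K E, star_hom g &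
  (forall v, g (sga K (sg_vtx v)) = p (V v)) /\
  (forall e, g (sga K (sg_edg e)) = p (D e)).
Proof.
pose f (x : vtx E + hedg E) : tame_cohn_alg K E :=
  match x with
  | inl v => p (V v) | inr (inl e) => p (D e) | inr (inr e) => p (star (D e))
  end.
have Wf x : tame_words0 (f x).
  right; case: x => [v|[e|e]] /=.
  - by exists (V v) => //; exact: sw_gen.
  - by exists (D e) => //; exact: sw_gen.
  - by exists (star (D e)) => //; apply: sw_star; exact: sw_gen.
have p0 := star_hom0 ph.
have R t u tu := congr1 p (@cohn_rel_gen t u tu).
have [|g [gX g0 gM gV]] := @isgp_star_lift _ _ _ tame_words0_pisgp _ rel f Wf.
  move=> t u [v|v w vw|x|x|v X e CX Xe|v X e h CX Xe Xh eh];
    apply: pisgp_val_inj; rewrite /= /pisgp_val /=.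
  - by rewrite -pM; exact: (R _ _ (cohn_vv _ v)).
  - by rewrite -pM -p0; exact: (R _ _ (cohn_vw _ vw)).
  - by case: x => e /=; rewrite -pM; [exact: (R _ _ (cohn_src _ e))
      |exact: (R _ _ (cohn_star_rng _ e))].
  - by case: x => e /=; rewrite -pM; [exact: (R _ _ (cohn_rng _ e))
      |exact: (R _ _ (cohn_star_src _ e))].
  - by rewrite -pM; exact: (R _ _ (cohn_ee _ CX Xe)).
  - by rewrite -pM -p0; exact: (R _ _ (cohn_ef _ CX Xe Xh eh)).
have [h hh hE] := sga_lift g0 gM gV.
by exists h => //; split=> x; rewrite hE gX.
Qed.

Lemma tame_iso : exists f : tame_cohn_alg K E -> sgp_alg K S, star_iso f.
Proof.
have [f fh [fV fD]] := tame_to_sga; have [g gh [gV gD]] := sga_to_tame.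
exists f; split=> //; exists g => [x|].
  have [c <-] := (squot_projP (tame_commutators K E)).2 x.
  apply: (@salg_hom_ext _ _ crel _ (g \o f \o p) p) => //.
    by apply: star_hom_comp => //; exact: star_hom_comp.
  by case=> [v|e] /=; rewrite ?fV ?gV ?fD ?gD.
apply: (@salg_hom_ext _ _ _ _ (f \o g) id) => [||s]; [exact: star_hom_comp|by []|].
have [_ fM fS] := fh; have [_ gM gS] := gh.
rewrite -/(sga K s) -[s]isgp_reprK -iseval_gen /=.
elim: (isgp_repr s) => [[v|[e|e]]||t IHt u IHu|t IHt] //=.
- by rewrite gV fV.
- by rewrite gD fD.
- by rewrite -/(sg_edgV e) -sg_edg_inv sgaV gS fS gD fD.
- by rewrite sga0 !star_hom0.
- by rewrite sgaM gM fM IHt IHu.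
- by rewrite sgaV gS fS IHt.
Qed.

End TameIso.

(** * Estimates in number fields *)

Section Powers.
Variable F : numFieldType.

Lemma expr_half_le n : (2^-1 : F) ^+ n <= n.+1%:R^-1.
Proof.
rewrite exprVn lef_pV2 ?posrE ?exprn_gt0 ?ltr0n //.
by rewrite -natrX ler_nat ltn_expl.
Qed.

(** Bernoulli's inequality for the inverse of the ratio; it makes an explicit
    power of a number just below 1 small, without limits. *)
Lemma expr_succ_ratio_le (k n : nat) : (0 < k)%N ->
  (k%:R / k.+1%:R : F) ^+ n <= k%:R / (k + n)%:R.
Proof.
move=> k0; elim: n => [|n IHn].
  by rewrite expr0 addn0 divff // pnatr_eq0 -lt0n.
rewrite exprSr; apply: le_trans (ler_wpM2r _ IHn) _.
  by rewrite divr_ge0 ?ler0n.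
rewrite mulf_div ler_pdivrMr ?mulr_gt0 ?ltr0n ?addn_gt0 ?k0 //.
rewrite mulrAC ler_pdivlMr ?ltr0n ?addn_gt0 ?k0 //.
by rewrite -!natrM ler_nat; nia.
Qed.

End Powers.

Section ComplexField.
Variable R : realType.

Lemma ltr_inv_nat (e : R[i]) : 0 < e -> exists n, n.+1%:R^-1 < e.
Proof.
move=> e0.
have er : e = (complex.Re e)%:C%C by rewrite RRe_real // ger0_real // ltW.
have r0 : 0 < complex.Re e by move: e0; rewrite {1}er ltcR.
exists (Num.truncn (complex.Re e)^-1).
rewrite er -(rmorph_nat (real_complex R)) -fmorphV ltcR.
rewrite -[ltRHS]invrK ltf_pV2 ?posrE ?invr_gt0 ?ltr0n //.
by rewrite truncnS_gt // num_real.
Qed.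

Lemma le_nat_bound (e : R[i]) : 0 <= e -> exists n, e <= n%:R.
Proof.
move=> e0; have e1 : 0 < (1 + e)^-1 by rewrite invr_gt0 ltr_wpDr.
have [n] := ltr_inv_nat e1.
rewrite ltf_pV2 ?posrE ?ltr0n ?ltr_wpDr // => /ltW h; exists n.+1.
by apply: le_trans h; rewrite lerDr.
Qed.

Lemma normc_real (r : R) : `|r%:C%C| = `|r|%:C%C.
Proof. by rewrite normc_def /= expr0n addr0 sqrtr_sqr. Qed.

End ComplexField.

(** * Resolvents in C*-algebras *)

Section CstarAlgebraTheory.
Variables (R : realType) (A : cstarAlgType R).
Implicit Types x y z a b c u v : A.

Lemma cstar_sqr_norm c : star c = c -> `|(c * c)%g| = `|c| ^+ 2.
Proof. by move=> {1}<-; exact: cstar_normE. Qed.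

(** The Neumann series without a unit: b is the sum of the a^n for n > 0, and
    1 + b is inverse to 1 - a. *)
Lemma quasi_inverse_exists a :
  `|a| <= 2^-1 -> exists b, b = (a + (b * a)%g)%R.
Proof.
move=> a2.
pose s n : A := iter n (fun b => (a + (b * a)%g)%R) 0.
have stepE n : `|s n.+1 - s n| <= (2^-1) ^+ n.+1.
  elim: n => [|n IHn]; first by rewrite /= starmul0l addr0 subr0 expr1.
  have -> : s n.+2 - s n.+1 = ((s n.+1 - s n)%R * a)%g.
    by rewrite starmulBl /= opprD addrACA subrr add0r.
  by apply: le_trans (cstar_normM _ _) _; rewrite exprSr ler_pM.
have distE n m : `|s n - s (n + m)%N| <= (2^-1) ^+ n - (2^-1) ^+ (n + m)%N.
  elim: m => [|m IHm]; first by rewrite addn0 !subrr normr0.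
  apply: le_trans (ler_distD (s (n + m)%N) _ _) _.
  apply: le_trans (lerD IHm _) _; first by rewrite distrC addnS; exact: stepE.
  by rewrite addnS exprSr le_eqVlt; apply/orP; left; apply/eqP; field.
have dist_le n m : (n <= m)%N -> `|s n - s m| <= n.+1%:R^-1.
  move=> nm; rewrite -(subnKC nm); apply: le_trans (distE _ _) _.
  apply: le_trans (expr_half_le _ n).
  by rewrite gerBl exprn_ge0 // invr_ge0 ler0n.
have s_cvg : cvgn s.
  apply/cauchy_cvgP/cauchy_exP => e /ltr_inv_nat[n ne].
  exists (s n); exists n => // m /= nm.
  by rewrite -ball_normE /=; exact: le_lt_trans (dist_le _ _ nm) ne.
exists (limn s); set b := limn s.
have bE e : 0 < e -> exists n, forall m, (n <= m)%N -> `|b - s m| < e.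
  by move=> e0; move: s_cvg => /cvgrPdist_lt/(_ e e0)[n _ ?]; exists n.
apply/eqP; rewrite -subr_eq0 -normr_le0; apply/ler_addgt0Pr => e e0.
have [n nE] := bE (e / 2) (divr_gt0 e0 (ltr0Sn _ 1)).
have -> : b - (a + (b * a)%g)%R = (b - s n.+1) + ((s n - b)%R * a)%g.
  by rewrite starmulBl /= !opprD !addrA subrK.
apply: le_trans (ler_normD _ _) _; rewrite add0r (splitr e) lerD //.
  by rewrite ltW // nE.
apply: le_trans (cstar_normM _ _) _; rewrite -[leRHS]mulr1 ler_pM //.
  by rewrite distrC ltW // nE.
by apply: le_trans a2 _; rewrite invf_le1 // ler1n.
Qed.

(** The hypothesis says that 1 + b is a left inverse of 1 - a. *)
Lemma quasi_inverse_bounded_below a b u :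
  b = (a + (b * a)%g)%R -> `|u| <= (1 + `|b|) * `|u - (a * u)%g|.
Proof.
move=> bE; have {1}-> : u = (u - (a * u)%g) + (b * (u - (a * u)%g)%R)%g.
  rewrite starmulBr mulgA -starmulBl.
  have {1}-> : b = (a + (b * a)%g)%R by [].
  by rewrite addrK subrK.
apply: le_trans (ler_normD _ _) _; rewrite mulrDl mul1r lerD2l.
exact: cstar_normM.
Qed.

Section Spectrum.
Variable c : A.

(** The set of z at which 1 - z c is bounded below is open, with control of
    the bound: 1 - z c is a perturbation of 1 - z0 c by (z - z0) c. *)
Lemma bounded_below_locally (m z z0 : R[i]) :
  0 <= m -> (forall u, `|u| <= m * `|u - z0 *: (c * u)%g|) ->
  m * (`|z - z0| * `|c|) <= 2^-1 ->
  forall u, `|u| <= (2 * m) * `|u - z *: (c * u)%g|.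
Proof.
move=> m0 hz0 zz0 u.
have h : `|u| <= m * `|u - z *: (c * u)%g| + 2^-1 * `|u|.
  apply: le_trans (hz0 u) _.
  have -> : u - z0 *: (c * u)%g
          = (u - z *: (c * u)%g) + (z - z0) *: (c * u)%g.
    by rewrite scalerBl addrA subrK.
  apply: le_trans (ler_wpM2l m0 (ler_normD _ _)) _.
  rewrite mulrDr lerD2l normrZ; apply: le_trans (ler_wpM2r _ zz0) => //.
  by rewrite -!mulrA ler_wpM2l // ler_wpM2l // cstar_normM.
rewrite -mulrA; set X := m * _ in h *; clearbody X.
move: h; rewrite -lerBlDr => h.
have -> : `|u| = 2 * (`|u| - 2^-1 * `|u|).
  by rewrite mulrBr mulrA divff ?pnatr_eq0 // mul1r mulr2n mulrDl mul1r addrK.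
by rewrite ler_wpM2l.
Qed.

(** Compactness of the unit disc turns pointwise bounds into one bound.  The
    disc is replaced by the square of the z with real and imaginary parts in
    [-1, 1], which is compact as a product of segments. *)
Lemma bounded_below_uniformly :
  (forall z : R[i], exists m, 0 <= m /\
     forall u, `|u| <= m * `|u - z *: (c * u)%g|) ->
  exists n : nat, forall z : R[i], `|z| <= 1 ->
    forall u, `|u| <= n%:R * `|u - z *: (c * u)%g|.
Proof.
move=> pointwise.
pose P (n : nat) (p : R * R) :=
  forall u : A, `|u| <= n%:R * `|u - (p.1 +i* p.2)%C *: (c * u)%g|.
have cpt : compact (`[(-1 : R), 1] `*` `[(-1 : R), 1]).
  by apply: compact_setX; exact: segment_compact.
have [n _ nP] : \forall n \near \oo, (`[(-1 : R), 1] `*` `[(-1 : R), 1]) `<=` P n.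
  apply: (compact_near_coveringP _).1 cpt _ _ _ _ _ => -[x y] _.
  have [m [m0 mP]] := pointwise (x +i* y)%C.
  have [e e0 me] : exists2 e : R, 0 < e & m * ((e + e)%:C%C * `|c|) <= 2^-1.
    have [k kP] := le_nat_bound (mulr_ge0 m0 (normr_ge0 c)).
    exists (k.+1 * 4)%:R^-1; first by rewrite invr_gt0 ltr0n.
    rewrite mulrCA rmorphD /= fmorphV rmorph_nat.
    apply: le_trans (ler_wpM2l _ kP) _.
      by rewrite addr_ge0 ?invr_ge0 ?ler0n.
    rewrite -[_^-1 + _]mulr2n -[_^-1 *+ 2]mulr_natl mulrAC ler_pdivrMr ?ltr0n //.
    by rewrite ler_pdivlMl ?ltr0n // -!natrM ler_nat; lia.
  have [k kP] := le_nat_bound (mulr_ge0 (ler0n _ 2) m0).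
  exists (ball (x, y) e, [set n | (k <= n)%N]).
    by split; [exact: nbhsx_ballx|exists k].
  move=> [[x' y'] n] /= [[/= bx by_] kn] u.
  apply: (@le_trans _ _ (2 * m * `|u - (x' +i* y')%C *: (c * u)%g|)); last first.
    by rewrite ler_wpM2r //; apply: le_trans kP _; rewrite ler_nat.
  apply: (bounded_below_locally m0 mP).
  apply: le_trans me; rewrite ler_wpM2l // ler_wpM2r //.
  have -> : (x' +i* y' - x +i* y)%C = (x' - x)%:C%C + 'i%C * (y' - y)%:C%C :> R[i].
    by simpc.
  apply: le_trans (ler_normD _ _) _; rewrite normrM complexiE normCi mul1r.
  rewrite [(e + e)%:C%C]rmorphD lerD //.
    by rewrite normc_real lecR distrC ltW.
  by rewrite normc_real lecR distrC ltW.
exists n => -[x y] z1 u; apply: (nP n _ (x, y)) => //=.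
have h (r : R) : `|r|%:C%C <= `|(x +i* y)%C| -> -1 <= r <= 1.
  by move=> /le_trans/(_ z1); rewrite lecR ler_norml.
split; rewrite /= in_itv /=; apply: h; first exact: (normc_ge_Re (x +i* y)%C).
have := normc_ge_Re ('i%C * (x +i* y)%C); rewrite normrM complexiE normCi mul1r.
by simpc; rewrite /= normrN.
Qed.

End Spectrum.
End CstarAlgebraTheory.

(** * Kernels of *-homomorphisms are closed *)

Section AutomaticContinuity.
Variables (R : realType) (A : cstarAlgType R).
Implicit Types (c u v x : A) (s w z M d : R[i]).

(** Writing x = (1 - w c) u and y = (1 - s w c) v, this says that the
    resolvents of c at w and at s w differ by at most d, and that the former is
    bounded by M.  It is stated without the resolvents, as an estimate for all u
    and v, so that neither a unit nor the existence of inverses is involved;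
    the term in x - y lets v be an approximate solution only. *)
Definition resolvent_close c s d M := forall w u v, `|w| = 1 ->
  `|u - v| <= d * `|v - (s * w) *: (c * v)%g|
            + M * `|(u - w *: (c * u)%g) - (v - (s * w) *: (c * v)%g)|.

(** The resolvent identity: (1 - w c)(u - v) = x - y + (1 - s) w c v, with x and
    y as above. *)
Lemma resolvent_close_base c s M : 0 <= M -> 0 <= s -> s <= 1 ->
  (forall z, `|z| <= 1 -> forall u, `|u| <= M * `|u - z *: (c * u)%g|) ->
  resolvent_close c s (M * M * (1 - s) * `|c|) M.
Proof.
move=> M0 s0 s1 bM w u v w1.
have sw1 : `|s * w| <= 1 by rewrite normrM w1 mulr1 ger0_norm.
set x' := v - _ *: _; set x := u - _ *: _.
have d0 : 0 <= 1 - s by rewrite subr_ge0.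
have -> : M * M * (1 - s) * `|c| * `|x'| = M * ((1 - s) * (`|c| * (M * `|x'|))).
  by ring.
have h := bM w; rewrite w1 lexx in h; apply: le_trans (h isT (u - v)) _.
rewrite -mulrDr ler_wpM2l // [leRHS]addrC.
have -> : (u - v) - w *: (c * (u - v)%R)%g
   = (x - x') + ((1 - s) * w) *: (c * v)%g.
  rewrite /x /x' starmulBr mulrBl mul1r scalerBr scalerBl.
  rewrite !opprB -[RHS]addrA [X in _ = _ + X]addrC [X in _ = _ + X]addrA subrK.
  by rewrite [_ - w *: (c * u)%g]addrC addrACA [_ - v]addrC.
apply: le_trans (ler_normD _ _) _; rewrite lerD2l normrZ normrM w1 mulr1.
rewrite (ger0_norm d0) ler_wpM2l //.
apply: le_trans (cstar_normM _ _) _; rewrite ler_wpM2l //; exact: bM.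
Qed.

(** If u = (1 - z^2 c^2)^{-1} x, then u + z c u = (1 - z c)^{-1} x. *)
Lemma resolvent_factor c z u :
  (u + z *: (c * u)%g) - z *: (c * (u + z *: (c * u)%g)%R)%g
  = u - (z ^+ 2) *: ((c * c) * u)%g.
Proof.
rewrite starmulDr scalerDr starmulZr scalerA expr2 mulgA opprD addrA.
by rewrite addrK.
Qed.

(** With z^2 = w, the vector u is the mean of u + z c u and u - z c u, which
    solve the equations for c at z and -z with the same right-hand side. *)
Lemma resolvent_close_sqr c s d M : 0 <= d -> 0 <= M ->
  resolvent_close c s d M -> resolvent_close (c * c)%g (s ^+ 2) d M.
Proof.
move=> d0 M0 h w u v w1.
pose z := sqrtc w.
have zw : z ^+ 2 = w by exact: sqr_sqrtc.
have z1 : `|z| = 1.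
  by apply/eqP; rewrite -(@pexpr_eq1 _ _ 2) // -normrX zw w1.
have zN1 : `|- z| = 1 by rewrite normrN.
set B := leRHS.
have hz y : `|y| = 1 -> y ^+ 2 = w ->
   `|(u + y *: (c * u)%g) - (v + (s * y) *: (c * v)%g)| <= B.
  move=> y1 yw; apply: le_trans (h y _ _ y1) _.
  by rewrite !resolvent_factor exprMn yw.
have -> : u - v = 2^-1 *: (((u + z *: (c * u)%g) - (v + (s * z) *: (c * v)%g))
   + ((u + (- z) *: (c * u)%g) - (v + (s * - z) *: (c * v)%g))).
  rewrite mulrN !scaleNr; move: (z *: _) (_ *: (c * v)%g) => p q.
  rewrite addrACA [(u + p) + _]addrACA subrr addr0 -opprD [(v + q) + _]addrACA.
  rewrite subrr addr0 -[u + u]mulr2n -[v + v]mulr2n -mulrnBl.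
  rewrite -[(u - v) *+ 2]scaler_nat scalerA.
  by rewrite mulVf ?scale1r // pnatr_eq0.
rewrite normrZ ger0_norm ?invr_ge0 ?ler0n // ler_pdivrMl ?ltr0n //.
apply: le_trans (ler_normD _ _) _; rewrite mulr_natl mulr2n lerD //; apply: hz => //.
by rewrite sqrrN.
Qed.

(** A self-adjoint c such that 1 - z c has a left inverse for all complex z has
    spectral radius 0.  The spectral radius formula is replaced by the explicit
    estimate of [resolvent_close] for the powers c^(2^j). *)
Lemma selfadj_entire_resolvent_eq0 c : star c = c ->
  (forall z, exists b, b = (z *: c + (b * (z *: c)%R)%g)%R) -> c = 0.
Proof.
move=> cs hq; apply: contrapT => /eqP c0.
wlog c1 : c cs hq c0 / `|c| = 1.
  have nc0 : 0 < `|c| by rewrite normr_gt0.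
  move=> wlog1; apply: (wlog1 (`|c|^-1 *: c)).
  - rewrite starZ cs; congr (_ *: _); apply: conj_Creal.
    by rewrite rpredV normr_real.
  - move=> z; have [b bE] := hq (z * `|c|^-1).
    by exists b; rewrite scalerA.
  - by rewrite scaler_eq0 invr_eq0 normr_eq0 (negPf c0).
  - by rewrite normrZ ger0_norm ?invr_ge0 // mulVf // gt_eqF.
have [n nP] : exists n : nat, forall z : R[i], `|z| <= 1 ->
     forall u, `|u| <= n%:R * `|u - z *: (c * u)%g|.
  apply: bounded_below_uniformly => z; have [b bE] := hq z.
  exists (1 + `|b|); split; first by rewrite addr_ge0.
  by move=> u; rewrite -starmulZl; exact: quasi_inverse_bounded_below.
(* t is close enough to 1 for d to be at most 1/8, and then j is large enough
   for s = t^(2^j) to be at most 1/(8 n). *)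
pose k := (16 * n * n).+1.
pose t : R[i] := k%:R / k.+1%:R.
have t0 : 0 <= t by rewrite divr_ge0.
have t1 : t <= 1 by rewrite ler_pdivrMr ?ltr0n // mul1r ler_nat.
pose d := n%:R * n%:R * (1 - t).
have d0 : 0 <= d by rewrite !mulr_ge0 // subr_ge0.
have d8 : d * 8 <= 1.
  rewrite /d; have -> : 1 - t = k.+1%:R^-1.
    rewrite /t -{1}(@divff _ k.+1%:R) ?pnatr_eq0 // -mulrBl.
    by rewrite -natrB // subSnn mul1r.
  by rewrite mulrAC ler_pdivrMr ?ltr0n // mul1r -!natrM ler_nat /k; lia.
pose q j := iter j (fun x : A => (x * x)%g) c.
have qs j : star (q j) = q j by elim: j => //= j IHj; rewrite starM IHj.
have q1 j : `|q j| = 1.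
  by elim: j => //= j IHj; rewrite cstar_sqr_norm // IHj expr1n.
have qclose j : resolvent_close (q j) (t ^+ (2 ^ j)) d n%:R.
  elim: j => [|j IHj].
    rewrite expn0 expr1; have := resolvent_close_base (ler0n _ n) t0 t1 nP.
    by rewrite c1 mulr1.
  by rewrite expnSr exprM; exact: resolvent_close_sqr.
pose j := (8 * n * k)%N; pose s := t ^+ (2 ^ j).
have s8 : s * (8 * n%:R) <= 1.
  apply: le_trans (ler_wpM2r _ (expr_succ_ratio_le _ _ _)) _ => //.
  rewrite mulrAC ler_pdivrMr ?ltr0n // mul1r -!natrM ler_nat.
  by have := ltn_expl j (isT : 1 < 2)%N; rewrite {1}/j; lia.
have s0 : 0 <= s by exact: exprn_ge0.
have s1 : s <= 1 by exact: exprn_ile1.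
(* At w = 1 take u = p, which solves (1 - p) u = x, and v = x, which nearly
   solves (1 - s p) v = x as s is small: their distance is |p^2| = 1. *)
pose p := q j; pose x := p - (p * p)%g.
have p1 : `|p| = 1 by exact: q1.
have pp1 : `|(p * p)%g| = 1 by rewrite cstar_sqr_norm ?p1 ?expr1n //; exact: qs.
have x2 : `|x| <= 2.
  by apply: le_trans (ler_normB _ _) _; rewrite p1 pp1.
have px2 : `|(p * x)%g| <= 2.
  by apply: le_trans (cstar_normM _ _) _; rewrite p1 mul1r.
have := qclose j 1 p x (normr1 _); rewrite -/s -/p mulr1 scale1r -/x.
have -> : p - x = (p * p)%g by rewrite /x opprB addrCA subrr addr0.
have -> : x - (x - s *: (p * x)%g) = s *: (p * x)%g.
  by rewrite opprB addrCA subrr addr0.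
rewrite pp1 normrZ ger0_norm // => le1.
have y4 : `|x - s *: (p * x)%g| <= 4.
  apply: le_trans (ler_normB _ _) _; rewrite normrZ ger0_norm //.
  have -> : 4 = 2 + 1 * 2 :> R[i] by ring.
  by rewrite lerD // ler_pM.
suff : (1 : R[i]) < 1 by rewrite ltxx.
apply: le_lt_trans le1 _; apply: (@le_lt_trans _ _ (2^-1 + 4^-1)).
  apply: lerD.
    apply: le_trans (ler_wpM2l d0 y4) _.
    rewrite -(ler_pM2r (ltr0Sn _ 1)) mulVf ?pnatr_eq0 //.
    by rewrite -mulrA -natrM.
  rewrite mulrA [n%:R * s]mulrC; apply: le_trans (ler_wpM2l _ px2) _.
    by rewrite mulr_ge0.
  rewrite -(ler_pM2r (ltr0Sn _ 3)) mulVf ?pnatr_eq0 //.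
  by apply: le_trans s8; rewrite le_eqVlt; apply/orP; left; apply/eqP; ring.
have -> : 2^-1 + 4^-1 = 3 / 4 :> R[i] by field.
by rewrite ltr_pdivrMr ?ltr0n // mul1r ltr_nat.
Qed.

End AutomaticContinuity.

Section Kernel.
Variables (R : realType) (A B : cstarAlgType R) (f : A -> B).
Hypothesis fh : star_hom f.

(** A limit x of elements of the kernel has the same image as the differences
    x - y with y in the kernel, which are arbitrarily small. *)
Lemma star_hom_ker_closed : closed [set x | f x = 0].
Proof.
have [fL fM fS] := fh.
have f0 : f 0 = 0 by have := fL (-1) 0 0; rewrite scaler0 addr0 scaleN1r addNr.
have fZ k x : f (k *: x) = k *: f x by have := fL k x 0; rewrite f0 !addr0.
have fB x y : f (x - y) = f x - f y.
  by have := fL (-1) y x; rewrite !scaleN1r [- y + x]addrC [- f y + f x]addrC.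
move=> x clx /=; apply: contrapT => /eqP fx0.
have small (e : R[i]) : 0 < e -> exists a, `|a| < e /\ f a = f x.
  move=> e0; have [y [fy0]] := clx _ (nbhsx_ballx x e e0).
  rewrite -ball_normE /= => xy; exists (x - y); split => //.
  by rewrite fB fy0 subr0.
suff : (star (f x) * f x)%g = 0.
  move=> /(congr1 (fun z => `|z|)); rewrite cstar_normE normr0 => /eqP.
  by rewrite expf_eq0 /= normr_eq0 (negPf fx0).
apply: selfadj_entire_resolvent_eq0; first by rewrite starM starK.
move=> z.
have e0 : 0 < (2 * (1 + `|z|))^-1 :> R[i].
  by rewrite invr_gt0 mulr_gt0 // ltr_wpDr.
have [a [ae fa]] := small _ e0.
have [b bE] : exists b,
    b = (z *: (star a * a)%g + (b * (z *: (star a * a)%g)%R)%g)%R.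
  apply: quasi_inverse_exists; rewrite normrZ cstar_normE expr2.
  have a1 : `|a| <= 1.
    apply: le_trans (ltW ae) _; rewrite invf_le1 ?mulr_gt0 ?ltr_wpDr //.
    by rewrite -[leLHS]mulr1 ler_pM // ?ler1n // lerDl.
  apply: (@le_trans _ _ ((1 + `|z|) * `|a|)).
    rewrite ler_pM ?mulr_ge0 //; first by rewrite lerDr.
    by rewrite ler_piMl.
  rewrite -ler_pdivlMl ?ltr_wpDr // -invfM mulrC; exact: ltW.
exists (f b); rewrite -fa -fS -fM -fZ -fM.
by have := fL 1 (z *: (star a * a)%g) (b * (z *: (star a * a)%g)%R)%g;
  rewrite !scale1r => <-; rewrite -bE.
Qed.

End Kernel.

(** * Enveloping C*-algebras and quotients *)

Section Enveloping.
Variable R : realType.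

Lemma enveloping_ext (A : starAlgType R[i]) (B D : cstarAlgType R)
    (iota : A -> B) (g h : B -> D) :
  is_enveloping iota -> star_hom g -> star_hom h ->
  (forall x, g (iota x) = h (iota x)) -> g =1 h.
Proof.
move=> [iotah /(_ D (g \o iota)) univ] gh hh gE x.
have [psi [_ psiU]] := univ (star_hom_comp gh iotah).
rewrite -(psiU g) // (psiU h) //; split => //.
by apply/funext => y /=; rewrite gE.
Qed.

Lemma star_hom_ker_closed_ideal (A B : cstarAlgType R) (f : A -> B) :
  star_hom f -> closed_ideal [set x | f x = 0].
Proof.
move=> fh; have [f0 fD fZ fM _] := star_hom_ker_ideal fh.
by split => //; exact: star_hom_ker_closed.
Qed.

(** Passing to the enveloping C*-algebra commutes with quotients: T and B both
    represent the *-homomorphisms from C to C*-algebras that kill G.  The kernel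
    of alpha : TP -> B contains the closed ideal generated by the image of G
    because it is itself a closed ideal. *)
Lemma enveloping_quotient_iso (C P : starAlgType R[i]) (G : set C)
    (TP T B : cstarAlgType R) (iota : C -> TP) (q : TP -> T) (iotaB : P -> B)
    (f : squot G -> P) :
  is_enveloping iota -> is_quotient (closed_ideal_gen (iota @` G)) q ->
  is_enveloping iotaB -> star_iso f -> exists h : T -> B, star_iso h.
Proof.
move=> envC [qh qsurj qker] envB [fh [f' fK f'K]].
have f'h := star_hom_can fh fK f'K.
have [ph psurj] := squot_projP G; set p := squot_proj G in ph psurj.
have [iotah Cuniv] := envC; have [iotaBh Buniv] := envB.
have [alpha [[alphah alphaE] _]] :=
  Cuniv B _ (star_hom_comp iotaBh (star_hom_comp fh ph)).
have {}alphaE x : alpha (iota x) = iotaB (f (p x)).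
  by rewrite -[LHS]/((alpha \o iota) x) alphaE.
have pG x : G x -> p x = 0.
  by move=> Gx; apply/squot_kerP => J [_]; apply.
have [h hh hE] : exists2 h : T -> B, star_hom h &
    forall x, h (q x) = alpha x.
  apply: star_hom_factor => // x /qker xJ; apply: (xJ [set y | alpha y = 0]).
  split; first exact: star_hom_ker_closed_ideal.
  by move=> _ [y Gy <-] /=; rewrite alphaE pG // !star_hom0.
have [k kh kE] : exists2 k : squot G -> T, star_hom k &
    forall x, k (p x) = q (iota x).
  apply: squot_lift; first exact: star_hom_comp.
  by move=> x Gx; apply/qker => J [_]; apply; exists x.
have [beta [[betah betaE] _]] := Buniv T _ (star_hom_comp kh f'h).
have {}betaE x : beta (iotaB (f x)) = k x.
  by rewrite -[LHS]/((beta \o iotaB) (f x)) betaE /= fK.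
exists h; split => //; exists beta => [y|].
  have [x <-] := qsurj y; rewrite hE.
  apply: (@enveloping_ext _ _ _ _ (beta \o alpha) q envC) => [|//|z /=].
    exact: star_hom_comp.
  by rewrite alphaE betaE kE.
apply: (@enveloping_ext _ _ _ _ (h \o beta) id envB) => [|//|y /=].
  exact: star_hom_comp.
rewrite -[y]f'K; have [x <-] := psurj (f' y).
by rewrite betaE kE hE alphaE.
Qed.

End Enveloping.

Theorem proposition6p5 (E : sepgraph) (noIso : forall v : vtx E, ~ isolated_vertex v)
    (K : involComPzRingType) (R : realType) :
  (exists f : tame_cohn_alg K E -> sgp_alg K (sepgraph_sgp E), star_iso f) /\
  (forall T B : cstarAlgType R,
     is_toeplitz_alg E T -> is_sgp_cstar_alg (sepgraph_sgp E) B ->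
     exists f : T -> B, star_iso f).
Proof.
split; first exact: tame_iso.
move=> T B [TP [iota [q [envC qT]]]] [iotaB envB].
have [f fiso] := tame_iso R[i] E.
exact: enveloping_quotient_iso envC qT envB fiso.
Qed.
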